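(* For any fan $\Sigma\subset N$, the irrational toric variety $Y_\Sigma$ is a $T_N$-equivariant cell complex. Each cell is a $T_N$-orbit and corresponds to a unique cone $\sigma\in\Sigma$. The cell corresponding to the cone $\sigma$ is $U_\sigma\simeq N/\langle\sigma\rangle$, and $\tau\subset\sigma$ if and only if $U_\sigma\subset\overline{U_\tau}$ (for $\sigma,\tau\in\Sigma$), so that the cell structure of $Y_\Sigma$ and its poset of containment-in-closure is dual to that of the fan $\Sigma$.
   Context: $M$ and $N$ are dual finite-dimensional real vector spaces with pairing $u\cdot v$; $\mathbb{R}_>$, $\mathbb{R}_\geq$ are the positive and nonnegative reals. A polyhedral cone is a set $\mathbb{R}_\geq v_1+\dots+\mathbb{R}_\geq v_k$; the dual of a cone $\sigma\subset N$ is $\sigma^\vee=\{u\in M\mid u\cdot v\geq0\ \forall v\in\sigma\}$; $\langle\sigma\rangle$ is its linear span and $\sigma^\perp\subset M$ its annihilator (the lineality space of $\sigma^\vee$). A face of $\sigma$ is a set $\{v\in\sigma\mid u\cdot v=0\}$ with $u\in\sigma^\vee$, and similarly for cones in $M$. A fan $\Sigma\subset N$ is a finite collection of polyhedral cones in $N$ closed under taking faces such that any two of its cones meet in a common face. $T_N$ is $N$ as a multiplicative group, identified with the group of continuous homomorphisms $M\to\mathbb{R}_>$ by $v\mapsto\gamma_v$, $\gamma_v(u)=\exp(-u\cdot v)$; for $t=\gamma_v$ write $t^u=\gamma_v(u)$. For a polyhedral cone $C\subset M$, $\mathrm{Hom}_c(C,\mathbb{R}_\geq)$ is the set of monoid homomorphisms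 $\varphi\colon(C,+)\to(\mathbb{R}_\geq,\times)$ (so $\varphi(0)=1$) that are continuous on the relative interior of each face of $C$, with the weakest topology making all evaluations at points of $C$ continuous. $T_N$ acts by $(t.\varphi)(u)=t^u\varphi(u)$. For $\sigma\in\Sigma$ put $V_\sigma=\mathrm{Hom}_c(\sigma^\vee,\mathbb{R}_\geq)$. For $\tau$ a face of $\sigma$, restriction from $\tau^\vee$ to $\sigma^\vee$ gives a $T_N$-equivariant inclusion $V_\tau\hookrightarrow V_\sigma$. The irrational toric variety $Y_\Sigma=\bigcup_{\sigma\in\Sigma}V_\sigma$ is obtained by gluing the $V_\sigma$ along these inclusions. For $\sigma\in\Sigma$, $x_\sigma\in V_\sigma$ is the homomorphism with value $1$ on $\sigma^\perp$ and $0$ on $\sigma^\vee\smallsetminus\sigma^\perp$, and $U_\sigma=T_N.x_\sigma$ is its orbit. The symbol $\simeq$ means $T_N$-equivariantly homeomorphic. ''$T_N$-equivariant cell complex'' means that the space, with its continuous $T_N$-action, is a finite disjoint union of $T_N$-stable cells, each homeomorphic to a real vector space, such that the closure of each cell is a union of cells. *)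

(* Defs.v *)
From HB Require Import structures.
From Stdlib Require Import Relation_Operators.
From mathcomp Require Import all_boot all_order all_algebra.
From mathcomp Require Import generic_quotient ring_quotient.
From mathcomp Require Import all_classical all_reals all_analysis.

Set Implicit Arguments.
Unset Strict Implicit.
Unset Printing Implicit Defensive.

Import Order.TTheory GRing.Theory Num.Theory.
Import numFieldNormedType.Exports.

Local Open Scope classical_set_scope.
Local Open Scope ring_scope.
Local Open Scope quotient_scope.

(* The library puts no topology on a [vectType].  [std V] is [V] with its usual
   topology, transported from R^d by the coordinates in a basis; it does not
   depend on the basis. *)
Definition std (R : realType) (V : vectType R) : Type := V.

HB.instance Definition _ (R : realType) (V : vectType R) :=
  Vector.copy (std V) V.
HB.instance Definition _ (R : realType) (V : vectType R) :=
  Topological.copy (std V) (initial_topology (passmx.rVof (vbasis {:V}))).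

Section StandardTopology.
Context {R : realType} (V : vectType R).

Lemma std_scalar_continuous (f : V -> R) :
  scalar f -> continuous (f : std V -> R).
Proof.
move=> lf.
pose g (x : 'rV[R]_(\dim {:V})) : R :=
  \sum_(j < \dim {:V}) x ord0 j * f (vbasis {:V})`_j.
have f0 : f 0 = 0.
  by have := lf 1 0 0; rewrite scaler0 addr0 mul1r => /eqP;
    rewrite -subr_eq subrr eq_sym => /eqP.
have fD u v : f (u + v) = f u + f v by rewrite -{1}[u]scale1r lf mul1r.
have fZ a u : f (a *: u) = a * f u by rewrite -[a *: u]addr0 lf f0 addr0.
have fE : f = g \o passmx.rVof (vbasis {:V}).
  apply/funext => v /=.
  rewrite -{1}(passmx.rVofK (vbasisP {:V}) v) /passmx.vecof (big_morph f fD f0).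
  by apply: eq_bigr => j _; rewrite fZ.
have cg : continuous g.
  apply: continuous_big => [|j _ x]; first exact: add_continuous.
  exact: (cvgMr_tmp (@coord_continuous R 1 _ ord0 j x)).
rewrite fE => x; apply: continuous_comp; first exact: initial_continuous.
exact: cg.
Qed.

Lemma std_line_continuous (x y : V) :
  continuous (fun a : R => x + a *: y : std V).
Proof.
apply: continuous_comp_initial.
have cl (A B : 'rV[R]_(\dim {:V})) : continuous (fun a : R => A + a *: B).
  by move=> a; apply: cvgD; [exact: cvg_cst | apply: cvgZr_tmp; exact: cvg_id].
have rE b : passmx.rVof (vbasis {:V}) (x + b *: y) =
    passmx.rVof (vbasis {:V}) x + b *: passmx.rVof (vbasis {:V}) y.
  by rewrite addrC passmx.rVof_linear addrC.
by have := cl (passmx.rVof (vbasis {:V}) x) (passmx.rVof (vbasis {:V}) y);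
  rewrite -(funext rE).
Qed.

End StandardTopology.

(* Two vector spaces in duality: a pairing nondegenerate on both sides. *)
Record dual_pairing (R : realType) (M N : vectType R) := DualPairing {
  pairing :> M -> N -> R;
  pairing_linearl : forall v, scalar (pairing^~ v);
  pairing_linearr : forall u, scalar (pairing u);
  pairing_nondegl : forall u, (forall v, pairing u v = 0) -> u = 0;
  pairing_nondegr : forall v, (forall u, pairing u v = 0) -> v = 0 }.

Definition flip_pairing (R : realType) (M N : vectType R)
    (P : dual_pairing M N) : dual_pairing N M :=
  @DualPairing R N M (fun v u => P u v)
    (pairing_linearr P) (pairing_linearl P)
    (pairing_nondegr (d := P)) (pairing_nondegl (d := P)).

Section Cones.
Context {R : realType}.

Definition polyhedral_cone (V : vectType R) (C : set (std V)) : Prop :=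
  exists s : seq V, C = [set x | exists a : 'I_(size s) -> R,
    (forall i, 0 <= a i) /\ x = \sum_(i < size s) a i *: s`_i].

Definition linspan (V : vectType R) (S : set (std V)) : set (std V) :=
  [set x | exists2 s : seq V, (forall y, y \in s -> S y) & x \in span s].

(* The interior of [C] as a subset of its linear span.  It is used only for
   cones, whose affine and linear spans agree. *)
Definition relint (V : vectType R) (C : set (std V)) : set (std V) :=
  interior (C : set (subspace (linspan C))).

Context {M N : vectType R} (P : dual_pairing M N).

Definition dual_cone (s : set (std N)) : set (std M) :=
  [set u | forall v, s v -> 0 <= P u v].

Definition annihilator (s : set (std N)) : set (std M) :=
  [set u | forall v, s v -> P u v = 0].

Definition face (t s : set (std N)) : Prop :=
  exists2 u, dual_cone s u & t = [set v | s v /\ P u v = 0].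

Definition is_fan (Sigma : set (set (std N))) : Prop :=
  [/\ finite_set Sigma,
      forall s, Sigma s -> polyhedral_cone s,
      forall s t, Sigma s -> face t s -> Sigma t &
      forall s t, Sigma s -> Sigma t ->
        face (s `&` t) s /\ face (s `&` t) t].

End Cones.

Section LinearSpan.
Context {R : realType} {V : vectType R}.

Definition span_pred (S : set (std V)) : {pred std V} :=
  [pred x | `[< linspan S x >]].

Lemma span_zmod_closed (S : set (std V)) : zmod_closed (span_pred S).
Proof.
split=> [|x y /asboolP[s sS xs] /asboolP[t tS yt]]; apply/asboolP.
  by exists [::] => //; rewrite mem0v.
exists (s ++ t) => [z|]; first by rewrite mem_cat => /orP[/sS|/tS].
by rewrite span_cat memv_add // rpredN.
Qed.

HB.instance Definition _ (S : set (std V)) :=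
  GRing.isZmodClosed.Build (std V) (span_pred S) (span_zmod_closed S).

(* The quotient [V / <S>] with the quotient topology, on which [V] acts by
   translation. *)
Definition span_quotient (S : set (std V)) : Type := Quotient.quot (span_pred S).

HB.instance Definition _ (S : set (std V)) :=
  Topological.copy (span_quotient S) (quotient_topology (span_quotient S)).
HB.instance Definition _ (S : set (std V)) :=
  Quotient.on (span_quotient S).

(* The sum is that of the quotient group [Quotient.quot (span_pred S)]. *)
Definition translate (S : set (std V)) (t : std V) (z : span_quotient S) :
    span_quotient S :=
  (\pi_(Quotient.quot (span_pred S)) t : Quotient.quot (span_pred S)) + z.

End LinearSpan.

Section ToricCharts.
Context {R : realType} {M N : vectType R} (P : dual_pairing M N).

(* [Hom_c(C, R_>=)]; the pointwise topology of [{ptws C -> R}] is the weakest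
   one for which all evaluations are continuous.  Since the sum of two elements
   of the subtype [C] is not available, multiplicativity is stated for every
   [w] in [C] that is the sum of [u] and [v]. *)
Definition homc (C : set (std M)) : set {ptws C -> R} :=
  [set phi : C -> R | [/\ forall u : C, 0 <= phi u,
    forall u : C, val u = 0 -> phi u = 1,
    forall u v w : C, val w = val u + val v -> phi w = phi u * phi v &
    forall F, face (flip_pairing P) F C ->
      {within [set u : C | relint F (val u)], continuous phi}]].
Arguments homc : clear implicits.

(* The torus [T_N] is [N]: [t : std N] stands for the homomorphism
   [gamma_t], and [tchar t u] is [t ^ u = gamma_t u]. *)
Definition tchar (t : std N) (u : std M) : R := expR (- P u t).

Lemma tcharD s t u : tchar (s + t) u = tchar s u * tchar t u.
Proof.
have := pairing_linearr P u 1 s t.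
by rewrite /tchar -expRD scale1r mul1r => ->; rewrite opprD.
Qed.

Lemma tchar_addr t u v : tchar t (u + v) = tchar t u * tchar t v.
Proof.
have := pairing_linearl P t 1 u v.
by rewrite /tchar -expRD scale1r mul1r => ->; rewrite opprD.
Qed.

Lemma pairing0l v : P 0 v = 0.
Proof.
have := pairing_linearl P v 1 0 0; rewrite scale1r addr0 mul1r => /eqP.
by rewrite -subr_eq subrr eq_sym => /eqP.
Qed.

Lemma pairing0r u : P u 0 = 0.
Proof.
have := pairing_linearr P u 1 0 0; rewrite scale1r addr0 mul1r => /eqP.
by rewrite -subr_eq subrr eq_sym => /eqP.
Qed.

Lemma tchar0 u : tchar 0 u = 1.
Proof. by rewrite /tchar pairing0r oppr0 expR0. Qed.

Lemma tchar_continuous t : continuous (tchar t).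
Proof.
have cP : continuous (fun u : std M => P u t).
  exact/std_scalar_continuous/pairing_linearl.
move=> u; apply: (@continuous_comp (std M) R R (fun u => - P u t) expR).
  exact: (continuousN (cP u)).
exact: continuous_expR.
Qed.

Lemma torus_hom_subproof (C : set (std M)) (t : std N) (phi : homc C) :
  homc C (fun u : C => tchar t (val u) * val phi u).
Proof.
have [phi_ge0 phi0 phiD phic] := set_valP phi; split.
- by move=> u; rewrite mulr_ge0 ?expR_ge0.
- by move=> u u0; rewrite phi0 // u0 /tchar pairing0l oppr0 expR0 mulr1.
- by move=> u v w uvw; rewrite (phiD u v w uvw) uvw tchar_addr mulrACA.
- move=> F fF x.
  have ct : continuous (fun u : C => tchar t (val u)).
    have cv : continuous (val : C -> std M) by exact: initial_continuous.
    by move=> y; exact: (continuous_comp (cv y) (@tchar_continuous t _)).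
  by have := cvgM (continuous_subspaceT ct (x := x)) (phic F fF x); exact.
Qed.

Definition torus_hom (C : set (std M)) (t : std N) (phi : homc C) : homc C :=
  SigSub (mem_set (torus_hom_subproof t phi)).

Lemma distinguished_subproof (s : set (std N)) :
  homc (dual_cone P s) (fun u : dual_cone P s => (`[< annihilator P s (val u) >])%:R).
Proof.
have PD v : {morph P^~ v : x y / x + y}.
  by move=> x y; have := pairing_linearl P v 1 x y; rewrite scale1r mul1r.
have PZ v a x : P (a *: x) v = a * P x v.
  by have := pairing_linearl P v a x 0; rewrite pairing0l !addr0.
split.
- by move=> u; rewrite ler0n.
- by move=> u u0; rewrite u0 asboolT // => v _; exact: pairing0l.
- move=> u v w uvw; rewrite -natrM mulnb; congr ((nat_of_bool _)%:R).
  rewrite uvw -asbool_and; apply: asbool_equiv_eq; split.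
    move=> h; split=> x sx; have := h x sx; rewrite PD => /eqP;
      rewrite paddr_eq0; try exact: (set_valP u x sx);
      try exact: (set_valP v x sx); by move=> /andP[/eqP ? /eqP ?].
  by move=> [h1 h2] x sx; rewrite PD h1 // h2 // addr0.
- move=> F [v0 _ FE].
  have Fdual x : F x -> dual_cone P s x by rewrite FE => -[].
  have spanF x y a : F x -> F y -> linspan F (x + a *: y).
    move=> Fx Fy; exists [:: x; y].
      by move=> z; rewrite !inE => /orP[] /eqP ->.
    by apply: memvD; [|apply: memvZ]; apply: memv_span; rewrite !inE eqxx ?orbT.
  have key x y : relint F x -> F y -> annihilator P s x -> annihilator P s y.
    move=> rx Fy ax v sv.
    have Fx : F x by exact: nbhs_singleton rx.
    have wx : within (linspan F) (nbhs (x : std M)) F.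
      by have := spanF x x 0 Fx Fx; rewrite scale0r addr0 => /nbhs_subspace_in ->.
    have := @std_line_continuous R M x y 0 _.
    rewrite /continuous_at scale0r addr0 => /(_ _ wx).
    rewrite !nbhs_simpl => /nbhs_ballP[e /= e0 he].
    have e2 : 0 < e / 2 by rewrite divr_gt0.
    have ball_e : ball (0 : R) e (- (e / 2)).
      rewrite /ball /= opprK add0r gtr0_norm //.
      by rewrite ltr_pdivrMr // ltr_pMr // ltr1n.
    have := Fdual _ (he _ ball_e (spanF x y (- (e / 2)) Fx Fy)) v sv.
    rewrite PD PZ ax // add0r mulNr oppr_ge0 pmulr_rle0 // => Py_le0.
    by apply/eqP; rewrite eq_le Py_le0 (Fdual _ Fy).
  apply/subspace_continuousP => x /= Ax; apply: cvg_near_cst.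
  rewrite near_withinE; apply: nearW => y /= Ay; congr ((nat_of_bool _)%:R).
  have Fx := nbhs_singleton Ax; have Fy := nbhs_singleton Ay.
  apply: asbool_equiv_eq; split; first exact: (key _ _ Ay Fx).
  exact: (key _ _ Ax Fy).
Qed.

Definition distinguished (s : set (std N)) : homc (dual_cone P s) :=
  SigSub (mem_set (distinguished_subproof s)).

End ToricCharts.

Arguments homc {R M N} P C _.

Section ToricVariety.
Context {R : realType} {M N : vectType R} (P : dual_pairing M N).
Context (Sigma : set (set (std N))).

(* [chart s] is V_sigma = Hom_c(sigma^vee, R_>=); [charts] carries the disjoint
   union topology. *)
Definition chart (s : Sigma) : topologicalType := homc P (dual_cone P (val s)).

Definition charts : Type := {s : Sigma & chart s}.

HB.instance Definition _ := Topological.on charts.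

(* [x] lies in V_tau, [y] in V_sigma, tau is a face of sigma, and [y] is the
   restriction of [x] from tau^vee to sigma^vee. *)
Definition restricts_to (x y : charts) : Prop :=
  face P (val (tag x)) (val (tag y)) /\
  forall (u : dual_cone P (val (tag x))) (w : dual_cone P (val (tag y))),
    val u = val w -> val (tagged x) u = val (tagged y) w.

Definition glue_rel : rel charts :=
  fun x y => `[< clos_refl_sym_trans charts restricts_to x y >].

Lemma glue_rel_refl : reflexive glue_rel.
Proof. by move=> x; apply/asboolP; exact: rst_refl. Qed.

Lemma glue_rel_sym : symmetric glue_rel.
Proof. by move=> x y; apply/asboolP/asboolP; exact: rst_sym. Qed.

Lemma glue_rel_trans : transitive glue_rel.
Proof.
by move=> y x z /asboolP xy /asboolP yz; apply/asboolP; exact: rst_trans yz.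
Qed.

Canonical glue_equiv :=
  EquivRel glue_rel glue_rel_refl glue_rel_sym glue_rel_trans.

Definition toric_variety : Type := {eq_quot glue_equiv}.

HB.instance Definition _ :=
  Topological.copy toric_variety (quotient_topology toric_variety).
HB.instance Definition _ := Quotient.on toric_variety.

Lemma toric_variety_eqP (x y : charts) :
  \pi_toric_variety x = \pi_toric_variety y <->
  clos_refl_sym_trans charts restricts_to x y.
Proof.
split.
  by move/(@eqquotP charts glue_rel {eq_quot glue_equiv})/asboolP.
by move/asboolP/(@eqquotP charts glue_rel {eq_quot glue_equiv}).
Qed.

Definition torus_charts (t : std N) (x : charts) : charts :=
  existT _ (tag x) (torus_hom t (tagged x)).

Definition torus_act (t : std N) (y : toric_variety) : toric_variety :=
  \pi_toric_variety (torus_charts t (repr y)).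

Lemma torus_act_pi t x :
  torus_act t (\pi_toric_variety x) = \pi_toric_variety (torus_charts t x).
Proof.
apply/toric_variety_eqP.
have /toric_variety_eqP : \pi_toric_variety (repr (\pi_toric_variety x)) =
    \pi_toric_variety x by rewrite reprK.
move: (repr _) => z; elim=> [a b [fab ab]|a|a b _|a b c _ + _]; last 3 first.
- exact: rst_refl.
- exact: rst_sym.
- exact: rst_trans.
by apply: rst_step; split=> // u w uw /=; rewrite uw (ab u w uw).
Qed.

(* [toric_point s] is x_sigma and its orbit [toric_cell s] is U_sigma. *)
Definition toric_point (s : Sigma) : toric_variety :=
  \pi_toric_variety (existT chart s (distinguished P (val s))).

Definition toric_cell (s : Sigma) : set toric_variety :=
  range (torus_act^~ (toric_point s)).

End ToricVariety.

(* Actions of [T_N], that is of the additive group of [N], on a space. *)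
Section Actions.
Context {R : realType} {N : vectType R}.

Definition continuous_action (X : topologicalType) (act : std N -> X -> X) :=
  [/\ forall x, act 0 x = x,
      forall s t x, act (s + t) x = act s (act t x) &
      continuous (fun p : std N * X => act p.1 p.2)].

Definition stable (X : Type) (act : std N -> X -> X) (A : set X) : Prop :=
  forall t x, A x -> A (act t x).

Definition is_orbit (X : Type) (act : std N -> X -> X) (A : set X) : Prop :=
  exists x, A = range (act^~ x).

Definition homeomorphism (X Y : topologicalType) (f : X -> Y) : Prop :=
  continuous f /\ exists g : Y -> X, [/\ continuous g, cancel f g & cancel g f].

(* [A] carries the subspace topology.  The equation makes [A] stable, because
   [f] maps onto [A]. *)
Definition equivariantly_homeomorphic (X Z : topologicalType)
    (actX : std N -> X -> X) (A : set X) (actZ : std N -> Z -> Z) : Prop :=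
  exists2 f : Z -> A, homeomorphism f &
    forall t z, val (f (actZ t z)) = actX t (val (f z)).

Definition equivariant_cell_complex (X : topologicalType)
    (act : std N -> X -> X) (cells : set (set X)) : Prop :=
  [/\ continuous_action act,
      finite_set cells /\ trivIset cells id /\ \bigcup_(c in cells) c = setT,
      forall c, cells c -> stable act c,
      forall c, cells c ->
        exists (V : vectType R) (f : c -> std V), homeomorphism f &
      forall c, cells c ->
        exists2 D, D `<=` cells & closure c = \bigcup_(d in D) d].

End Actions.

(* Main.v *)
From HB Require Import structures.
Require Import Defs.
From Stdlib Require Import Relation_Operators.
From mathcomp Require Import all_boot all_order all_algebra.
From mathcomp Require Import generic_quotient ring_quotient.
From mathcomp Require Import all_classical all_reals all_analysis.

Set Implicit Arguments.
Unset Strict Implicit.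
Unset Printing Implicit Defensive.

Import Order.TTheory GRing.Theory Num.Theory.
Import numFieldNormedType.Exports.

Local Open Scope classical_set_scope.
Local Open Scope ring_scope.
Local Open Scope quotient_scope.

(** Every point [phi] of the chart [V_s] is the image [t . x_k] of a point of the
    orbit of [x_k], for one face [k] of [s] and one [t] modulo the span of [k].
    Everything else follows from this classification ([homc_orbit_fun],
    [orbit_fun_inj]).

    The support of [phi], where [phi] is positive, is closed under sums, and
    a sum is in it only if its terms are. Choose [u0] in the support, positive on
    as many generators of [s] as possible, and let [k] be the face of [s] on
    which [u0] vanishes. A large multiple of [u0] dominates each functional [u]
    of [s^vee] that annihilates [k], so [u] is in the support; hence the support
    is the part of [s^vee] annihilating [k]. There [ln phi] is additive, and it
    extends to the whole annihilator of [k] because each element of it becomes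
    one of [s^vee] after adding a multiple of [u0]. As [u0] is a relative
    interior point of the face cut out by [k], continuity there makes the
    extension linear on lines, hence linear, hence the pairing with a vector of
    [N]. Thus [phi] is a character on its support.

    The pair of [k] and [t] is invariant under restriction to larger cones, so
    it is a complete invariant of the points of [Y] ([orbit_inj],
    [orbit_coords_pi]): the orbits of the points [x_k] partition [Y].

    The charts are open in [Y] ([chart_map_nbhs]). If [w] in [r^vee] cuts out the
    common face of [s] and [r], the overlap is the locus [psi w > 0] in [V_r], and
    the values of the corresponding point of [V_s] are quotients
    [psi (z + w *+ n) / psi w ^+ n], which are continuous in [psi]. So the
    topology can be studied in the charts, where it is pointwise convergence:
    the action is continuous; the logarithms of [phi] at a basis of the annihilator
    of [k] are continuous coordinates on the cell of [k], which gives a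
    continuous section of [t |-> t . x_k] and with it both descriptions of the
    cell; and for [v] the sum of generators of [s] and [t] a face of [s], the
    points [n v . x_t] tend to [x_s]. Conversely [V_s] is a neighbourhood of [x_s]
    meeting only the cells of faces of [s], which determines the closures. *)

(** * Linear functionals and duality *)

Section ScalarFunctionals.
Context {R : realType} {V : vectType R} (f : V -> R).
Hypothesis f_scalar : scalar f.

Lemma functionalD u v : f (u + v) = f u + f v.
Proof. by rewrite -{1}[u]scale1r f_scalar mul1r. Qed.

Lemma functional0 : f 0 = 0.
Proof. by apply: (@addrI _ (f 0)); rewrite -functionalD !addr0. Qed.

Lemma functionalZ a u : f (a *: u) = a * f u.
Proof. by rewrite -[a *: u]addr0 f_scalar functional0 addr0. Qed.

Lemma functional_sum I (r : seq I) (Q : pred I) (F : I -> V) :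
  f (\sum_(i <- r | Q i) F i) = \sum_(i <- r | Q i) f (F i).
Proof. exact: (big_morph f functionalD functional0). Qed.

End ScalarFunctionals.

Section Duality.
Context {R : realType} {M N : vectType R} (P : dual_pairing M N).

Lemma pairingDl u u' v : P (u + u') v = P u v + P u' v.
Proof. exact: (functionalD (pairing_linearl P v)). Qed.

Lemma pairingDr u v v' : P u (v + v') = P u v + P u v'.
Proof. exact: (functionalD (pairing_linearr P u)). Qed.

Lemma pairingZl a u v : P (a *: u) v = a * P u v.
Proof. exact: (functionalZ (pairing_linearl P v)). Qed.

Lemma pairingZr a u v : P u (a *: v) = a * P u v.
Proof. exact: (functionalZ (pairing_linearr P u)). Qed.

Lemma pairingMnl u n v : P (u *+ n) v = n%:R * P u v.
Proof. by rewrite -scaler_nat pairingZl. Qed.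

Lemma pairingBl u u' v : P (u - u') v = P u v - P u' v.
Proof. by rewrite -[- u']scaleN1r pairingDl pairingZl mulN1r. Qed.

Lemma pairingBr u v v' : P u (v - v') = P u v - P u v'.
Proof. by rewrite -[- v']scaleN1r pairingDr pairingZr mulN1r. Qed.

Lemma pairing_sumr u I (r : seq I) (Q : pred I) (F : I -> N) :
  P u (\sum_(i <- r | Q i) F i) = \sum_(i <- r | Q i) P u (F i).
Proof. exact: (functional_sum (pairing_linearr P u)). Qed.

End Duality.

Section PairingCoordinates.
Context {R : realType} {M N : vectType R} (P : dual_pairing M N) (s : seq M).

Definition pairing_row (v : N) : 'rV[R]_(size s) := \row_j P s`_j v.

Lemma pairing_row_linear : linear pairing_row.
Proof. by move=> a u v; apply/rowP => j; rewrite !mxE pairingDr pairingZr. Qed.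

HB.instance Definition _ :=
  GRing.isLinear.Build R N _ _ pairing_row pairing_row_linear.

Lemma pairing_row_inj : span s = fullv -> injective pairing_row.
Proof.
move=> s_full u v /rowP uv; apply/eqP; rewrite -subr_eq0; apply/eqP.
apply: (pairing_nondegr (d := P)) => w.
have /coord_span -> : w \in span (in_tuple s) by rewrite s_full memvf.
rewrite (functional_sum (pairing_linearl P _)).
apply: big1 => i _; rewrite pairingZl pairingBr.
by have := uv i; rewrite !mxE => ->; rewrite subrr mulr0.
Qed.

Lemma dim_limg_pairing_row :
  span s = fullv -> \dim (limg (linfun pairing_row)) = dim N.
Proof.
move=> s_full; rewrite limg_dim_eq ?dimvf //.
suff /eqP -> : lker (linfun pairing_row) == 0%VS by rewrite capv0.
by apply/lker0P => u v; rewrite !lfunE; exact: pairing_row_inj.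
Qed.

End PairingCoordinates.

Lemma size_vbasis (R : realType) (M : vectType R) :
  size (vbasis {:M}) = dim M.
Proof. by rewrite size_tuple dimvf. Qed.

Lemma dual_pairing_dim_le (R : realType) (M N : vectType R)
  (P : dual_pairing M N) : (dim N <= dim M)%N.
Proof.
rewrite -(dim_limg_pairing_row P (span_basis (vbasisP _))).
by apply: leq_trans (dimvS (subvf _)) _; rewrite dimvf dim_matrix mul1r size_vbasis.
Qed.

(** Pairing with a basis of [M] embeds [N] into R^(dim M), so dim N <= dim M.
    The same on the other side gives equality, and the embedding is onto. *)
Lemma pairing_represents (R : realType) (M N : vectType R)
    (P : dual_pairing M N) (l : M -> R) :
  scalar l -> exists v : N, forall u, l u = P u v.
Proof.
move=> l_scalar; pose e : seq M := vbasis {:M}.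
have onto : limg (linfun (pairing_row P e)) = fullv.
  apply/eqP; rewrite -(dimv_leqif_eq (subvf _)) dim_limg_pairing_row; last first.
    exact: span_basis (vbasisP _).
  rewrite dimvf dim_matrix mul1r size_vbasis eqn_leq dual_pairing_dim_le //.
  exact: (dual_pairing_dim_le (flip_pairing P)).
have /memv_imgP[v _] :
    (\row_j l e`_j) \in limg (linfun (pairing_row P e)) by rewrite onto memvf.
rewrite lfunE /= => /rowP lv; exists v => u.
have /coord_span -> : u \in span (in_tuple e).
  by rewrite (span_basis (vbasisP _)) memvf.
rewrite (functional_sum l_scalar).
rewrite (functional_sum (pairing_linearl P v)); apply: eq_bigr => i _.
by rewrite (functionalZ l_scalar) pairingZl; have := lv i; rewrite !mxE => ->.
Qed.

Lemma common_kernel (R : realType) (M N : vectType R) (P : dual_pairing M N)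
    (s : seq N) :
  exists W : {vspace M}, forall u, u \in W <-> forall v, v \in s -> P u v = 0.
Proof.
exists (lker (linfun (pairing_row (flip_pairing P) s))) => u.
rewrite memv_ker lfunE /=; split=> [/eqP/rowP us v vs|us].
  have vi : (index v s < size s)%N by rewrite index_mem.
  by have := us (Ordinal vi); rewrite !mxE /= nth_index.
by apply/eqP/rowP => j; rewrite !mxE /= us // mem_nth.
Qed.

(** A vector outside a subspace is detected by a functional vanishing on it:
    a nonzero coordinate of its component in a complement. *)
Lemma separate_span (R : realType) (M N : vectType R) (P : dual_pairing M N)
    (s : seq N) (x : N) :
  x \notin span s -> exists2 u : M, (forall v, v \in s -> P u v = 0) & P u x != 0.
Proof.
move=> xs; pose q (v : N) := v - projv (span s) v.
have qx : q x != 0.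
  by apply: contra xs; rewrite subr_eq0 => /eqP ->; exact: memv_proj.
have [i cx] : exists i, coord (vbasis {:N}) i (q x) != 0.
  apply: contrapT => /forallNP h; case/eqP: qx.
  rewrite (coord_vbasis (memvf (q x))); apply: big1 => i _.
  by have /negP/negPn/eqP -> := h i; rewrite scale0r.
have [a u v|u uP] := @pairing_represents R N M (flip_pairing P)
    (fun v => coord (vbasis {:N}) i (q v)).
  rewrite -linearP; congr (coord _ _ _).
  by rewrite /q linearP scalerBr opprD addrACA.
exists u => [v vs|]; last by move: cx; rewrite uP.
by have := uP v; rewrite /= /q projv_id ?memv_span // subrr linear0.
Qed.

(** * Convergence in a vector space *)

Lemma cvg_initial (S : choiceType) (T : topologicalType) (w : S -> T)
    (X : Type) (F : set_system X) (FF : Filter F) (g : X -> S) (x : S) :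
  w (g z) @[z --> F] --> w x -> g z @[z --> F] --> (x : initial_topology w).
Proof.
move=> wg A [_ [[B oB <-] Bx BA]].
by apply: (filterS BA); apply: wg; exact: open_nbhs_nbhs.
Qed.

Lemma cvg_mx (R : realType) (m n : nat) (X : Type) (F : set_system X)
    (FF : Filter F) (g : X -> 'M[R]_(m, n)) (A : 'M[R]_(m, n)) :
  (forall i j, g x i j @[x --> F] --> A i j) -> g x @[x --> F] --> A.
Proof.
move=> gA U [Q AQ QU]; apply: (filterS (P := fun x => forall i j, Q i j (g x i j))).
  by move=> x Qx; apply: QU.
by apply: filter_forall => i; apply: filter_forall => j; apply: gA; exact: AQ.
Qed.

(** The coordinates that define the topology of [std V] are linear functionals,
    so convergence can be tested without reference to a basis. *)
Lemma cvg_std (R : realType) (V : vectType R) (X : Type) (F : set_system X)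
    (FF : Filter F) (g : X -> std V) (x : std V) :
  (forall l : V -> R, scalar l -> l (g z) @[z --> F] --> l x) ->
  g z @[z --> F] --> x.
Proof.
move=> lg; apply: cvg_initial; apply: cvg_mx => i j.
rewrite !ord1; apply: (lg (fun v => passmx.rVof (vbasis {:V}) v 0 j)) => a u v.
by rewrite /= passmx.rVof_linear !mxE.
Qed.

Lemma std_linear_continuous (R : realType) (V W : vectType R) (f : V -> W) :
  linear f -> continuous (f : std V -> std W).
Proof.
move=> f_lin v; apply: (@cvg_std _ _ _ _ (nbhs_filter v)) => l l_scalar.
apply: (std_scalar_continuous (f := l \o f)) => a x y /=.
by rewrite f_lin l_scalar.
Qed.

(** An additive function differs from a linear one by a function vanishing on
    every fraction, and each real number is as close as we wish to a fraction. *)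
Lemma additive_continuous_linear (R : realType) (g : R -> R) :
  (forall x y, g (x + y) = g x + g y) -> g x @[x --> 0] --> (0 : R) ->
  forall a, g a = a * g 1.
Proof.
move=> gD g0.
pose D x := g x - x * g 1.
have DD x y : D (x + y) = D x + D y by rewrite /D gD mulrDl opprD addrACA.
have D0 : D x @[x --> 0] --> (0 : R).
  rewrite -[X in _ --> X](subr0 0); apply: cvgB => //.
  rewrite -[X in _ --> X](mul0r (g 1)); apply: cvgM; [exact: cvg_id|exact: cvg_cst].
have DMn x n : D (x *+ n) = D x *+ n.
  elim: n => [|n IH]; last by rewrite !mulrS DD IH.
  by rewrite !mulr0n; apply: (@addrI _ (D 0)); rewrite -DD !addr0.
have DN x : D (- x) = - D x.
  by apply: (@addrI _ (D x)); rewrite -DD !subrr -(mulr0n 0) DMn mulr0n.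
have Dfrac (n : nat) (z : int) : D (z%:~R / n.+1%:R) = 0.
  have D1n : D (n.+1%:R^-1) = 0.
    apply/eqP; have := DMn (n.+1%:R^-1) n.+1.
    rewrite -(mulr_natl _^-1) mulfV ?pnatr_eq0 // {1}/D mul1r subrr => /esym/eqP.
    by rewrite mulrn_eq0.
  case: z => m; rewrite ?NegzE ?mulrNz ?mulNr ?DN -pmulrn mulr_natl DMn D1n mul0rn ?oppr0 //.
move=> a; apply/eqP; rewrite -subr_eq0 -/(D a) -normr_le0.
apply/ler_addgt0Pl => e e0; rewrite addr0.
have /nbhs_ballP[d /= d0 De] : \forall x \near 0, `|D x| < e.
  have /cvgrPdist_lt/(_ e e0) := D0.
  by apply: filterS => x; rewrite sub0r normrN.
have [n nd] : exists n, n.+1%:R^-1 < d.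
  exists (Num.bound d^-1); rewrite invf_plt ?posrE //.
  apply: lt_trans (archi_boundP _) _; first by rewrite invr_ge0 ltW.
  by rewrite ltr_nat.
pose z : int := Num.floor (a * n.+1%:R).
have -> : D a = D (a - z%:~R / n.+1%:R) by rewrite DD DN Dfrac subr0.
apply/ltW/De; rewrite /ball /= sub0r normrN.
apply: le_lt_trans nd.
rewrite -[a](mulfK (_ : n.+1%:R != 0)) ?pnatr_eq0 // -mulrBl normrM.
rewrite [X in _ * X]ger0_norm ?invr_ge0 // ler_piMl ?invr_ge0 //.
have := floor_itv (a * n.+1%:R); rewrite -/z => /andP[z1 z2].
rewrite ger0_norm ?subr_ge0 // lerBlDl; apply: ltW.
by move: z2; rewrite intrD.
Qed.

(** * Generators of a polyhedral cone *)

Section Generators.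
Context {R : realType} {M N : vectType R} (P : dual_pairing M N).

Lemma flip_pairingE v u : flip_pairing P v u = P u v.
Proof. by []. Qed.

Lemma dual_coneD (s : set (std N)) u w :
  dual_cone P s u -> dual_cone P s w -> dual_cone P s (u + w).
Proof. by move=> su sw v sv; rewrite pairingDl addr_ge0 ?su ?sw. Qed.

Lemma dual_cone0 (s : set (std N)) : dual_cone P s 0.
Proof. by move=> v _; rewrite pairing0l. Qed.

Lemma dual_coneMn (s : set (std N)) u n :
  dual_cone P s u -> dual_cone P s (u *+ n).
Proof. by move=> su v sv; rewrite pairingMnl mulr_ge0 ?su. Qed.

Lemma annihilatorD (s : set (std N)) u w :
  annihilator P s u -> annihilator P s w -> annihilator P s (u + w).
Proof. by move=> su sw v sv; rewrite pairingDl su ?sw ?addr0. Qed.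

Lemma annihilatorZ (s : set (std N)) a u :
  annihilator P s u -> annihilator P s (a *: u).
Proof. by move=> su v sv; rewrite pairingZl su ?mulr0. Qed.

Lemma annihilatorMn (s : set (std N)) n u :
  annihilator P s u -> annihilator P s (u *+ n).
Proof. by rewrite -scaler_nat; exact: annihilatorZ. Qed.

(** Nonnegative numbers with sum zero vanish. This makes the indicator of an
    annihilator multiplicative on the dual cone. *)
Lemma annihilator_addE (s k : set (std N)) u w : k `<=` s ->
  dual_cone P s u -> dual_cone P s w ->
  annihilator P k (u + w) <-> annihilator P k u /\ annihilator P k w.
Proof.
move=> ks su sw; split=> [uw|[]]; last exact: annihilatorD.
suff uw0 v : k v -> (P u v == 0) && (P w v == 0).
  by split=> v /uw0/andP[/eqP ? /eqP ?].
by move=> kv; rewrite -paddr_eq0 ?su ?sw -?pairingDl ?uw //; exact: ks.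
Qed.

Definition generated_by (C : set (std N)) (s : seq N) : Prop :=
  (forall v, v \in s -> C v) /\
  forall x, C x -> exists a : 'I_(size s) -> R,
    (forall i, 0 <= a i) /\ x = \sum_(i < size s) a i *: s`_i.

Lemma polyhedral_generated (C : set (std N)) :
  polyhedral_cone C -> exists s, generated_by C s.
Proof.
move=> [s CE]; exists s; split=> [v vs|x]; last by rewrite CE.
have vi : (index v s < size s)%N by rewrite index_mem.
rewrite CE; exists (fun i => (i == Ordinal vi)%:R); split=> [i|].
  by rewrite ler0n.
rewrite (bigD1 (Ordinal vi)) //= eqxx scale1r nth_index // big1 ?addr0 // => i.
by move=> /negPf ->; rewrite scale0r.
Qed.

Section GeneratedCone.
Context (C : set (std N)) (s : seq N).
Hypothesis gens : generated_by C s.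

Lemma dual_cone_generated u : (forall v, v \in s -> 0 <= P u v) -> dual_cone P C u.
Proof.
move=> us v Cv; have [a [a0 ->]] := gens.2 v Cv; rewrite pairing_sumr.
by apply: sumr_ge0 => i _; rewrite pairingZr mulr_ge0 ?us ?mem_nth.
Qed.

(** A nonnegative combination of generators on which [u0] vanishes involves only
    generators on which [u0] vanishes, so these span the face. *)
Lemma annihilator_generated u0 u : dual_cone P C u0 ->
  annihilator P [set v | C v /\ P u0 v = 0] u <->
  forall v, v \in s -> P u0 v = 0 -> P u v = 0.
Proof.
move=> Cu0; split=> [h v vs u0v|h v [Cv]]; first by apply: h; split=> //; exact: gens.1.
have [a [a0 ->]] := gens.2 v Cv; rewrite !pairing_sumr => /eqP.
rewrite psumr_eq0 => [/allP h0|i _]; last first.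
  by rewrite pairingZr mulr_ge0 // Cu0 //; apply: gens.1; rewrite mem_nth.
apply: big1 => i _; have := h0 i (mem_index_enum _).
rewrite /= !pairingZr mulf_eq0 => /orP[/eqP ->|/eqP /h ->]; rewrite ?mul0r ?mulr0 //.
exact: mem_nth.
Qed.

Lemma annihilator_generators u :
  annihilator P C u <-> forall v, v \in s -> P u v = 0.
Proof.
split=> [uC v vs|us v Cv]; first by apply: uC; exact: gens.1.
have [a [_ ->]] := gens.2 v Cv; rewrite pairing_sumr; apply: big1 => i _.
by rewrite pairingZr us ?mulr0 ?mem_nth.
Qed.

(** A vector outside the span of the generators is separated from it. *)
Lemma linspan_generated x :
  linspan C x <-> forall u, annihilator P C u -> P u x = 0.
Proof.
split=> [[t tC xt] u uC|h].
  have /coord_span -> : x \in span (in_tuple t) by [].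
  rewrite pairing_sumr; apply: big1 => i _.
  by rewrite pairingZr uC ?mulr0 //; apply/tC/mem_nth.
exists s; first exact: gens.1.
apply: contrapT => /negP/(separate_span P)[u us /eqP]; apply; apply: h.
exact/annihilator_generators.
Qed.

Lemma annihilator_vspace :
  exists W : {vspace M}, forall u, u \in W <-> annihilator P C u.
Proof.
by have [W WE] := common_kernel P s; exists W => u; rewrite WE annihilator_generators.
Qed.

End GeneratedCone.

(** On the generators where [u0] is positive, a large multiple of it dominates
    any given functional. *)
Lemma absorb (s : seq N) (u0 w : M) :
  (forall v, v \in s -> 0 <= P u0 v) ->
  (forall v, v \in s -> P u0 v = 0 -> 0 <= P w v) ->
  exists n, forall v, v \in s -> 0 <= P (w + u0 *+ n) v.
Proof.
elim: s => [|x s IH] u0s ws; first by exists 0%N.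
have [v vs|v vs|n nP] := IH.
- by apply: u0s; rewrite inE vs orbT.
- by apply: ws; rewrite inE vs orbT.
have x_in : x \in x :: s by rewrite mem_head.
have [m mP] : exists m, 0 <= P w x + m%:R * P u0 x.
  have [u0x|u0x] := eqVneq (P u0 x) 0; first by exists 0%N; rewrite mul0r addr0 ws.
  have {}u0x : 0 < P u0 x by rewrite lt_def u0x u0s.
  exists (Num.bound (`|P w x| / P u0 x)).
  rewrite -lerBlDl sub0r; apply: le_trans (ler_norm _) _; rewrite normrN.
  rewrite -ler_pdivrMr //; apply/ltW/archi_boundP.
  by rewrite divr_ge0 // ltW.
exists (n + m)%N => v; rewrite inE => /orP[/eqP ->|vs].
  rewrite mulrnDr [_ *+ n + _]addrC addrA pairingDl pairingMnl.
  by rewrite addr_ge0 ?pairingDl ?pairingMnl // mulr_ge0 ?u0s.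
rewrite mulrnDr addrA pairingDl addr_ge0 ?nP // pairingMnl mulr_ge0 // u0s //.
by rewrite inE vs orbT.
Qed.

Lemma dual_cone_absorb (C : set (std N)) (s : seq N) (u0 w : M) :
  generated_by C s -> dual_cone P C u0 -> dual_cone P [set v | C v /\ P u0 v = 0] w ->
  exists n, dual_cone P C (w + u0 *+ n).
Proof.
move=> gens Cu0 Fw.
have [v vs|v vs u0v|n nP] := @absorb s u0 w.
- by apply: Cu0; exact: gens.1.
- by apply: Fw; split=> //; exact: gens.1.
by exists n; exact: (dual_cone_generated gens).
Qed.

Lemma near_pairing_gt0 (s : seq N) (T : topologicalType) (x : T) (g : T -> std M) :
  {for x, continuous g} ->
  \forall y \near x, forall v, v \in s -> 0 < P (g x) v -> 0 < P (g y) v.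
Proof.
move=> cg; elim: s => [|v s IH]; first exact: nearW.
have near_v : \forall y \near x, 0 < P (g x) v -> 0 < P (g y) v.
  have [gv|gv] := ltP 0 (P (g x) v); last by apply: nearW.
  have cP : {for x, continuous (fun y => P (g y) v)}.
    apply: (@continuous_comp _ (std M) R g (P^~ v) _ cg).
    exact: (std_scalar_continuous (pairing_linearl P v)).
  by apply: filterS (cvgr_gt _ cP _ gv).
apply: filterS2 near_v IH => y y1 y2 w; rewrite inE => /orP[/eqP ->|]; first exact: y1.
exact: y2.
Qed.

End Generators.

(** * Homomorphisms on a dual cone *)

Section TotalExtension.
Context {R : realType} {V : vectType R} (C : set (std V)).

(** Extension by zero, so that arguments can be added in [V] without carrying
    membership proofs. *)
Definition total_ext (phi : C -> R) (u : std V) : R :=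
  if pselect (C u) is left Cu then phi (SigSub (mem_set Cu)) else 0.

Lemma total_extE phi (u : C) : total_ext phi (val u) = phi u.
Proof.
rewrite /total_ext; case: pselect => [Cu|[]]; last exact: set_valP.
by congr (phi _); exact: val_inj.
Qed.

Lemma total_ext_in phi u (Cu : C u) : total_ext phi u = phi (SigSub (mem_set Cu)).
Proof. by rewrite -total_extE. Qed.

End TotalExtension.

Section Homc.
Context {R : realType} {M N : vectType R} (P : dual_pairing M N).
Context (C : set (std M)) (phi : homc P C).
Local Notation f := (total_ext (val phi)).

Lemma total_ext_ge0 u : 0 <= f u.
Proof.
have [phi_ge0 _ _ _] := set_valP phi.
by rewrite /total_ext; case: pselect => // Cu; exact: phi_ge0.
Qed.

Lemma total_ext0 : C 0 -> f 0 = 1.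
Proof.
have [_ phi0 _ _] := set_valP phi.
by move=> C0; rewrite (total_ext_in _ C0) phi0.
Qed.

Lemma total_extD u w : C u -> C w -> C (u + w) -> f (u + w) = f u * f w.
Proof.
have [_ _ phiD _] := set_valP phi.
move=> Cu Cw Cuw; rewrite (total_ext_in _ Cu) (total_ext_in _ Cw) (total_ext_in _ Cuw).
exact: phiD.
Qed.

(** Continuity on the relative interior of a face, along a path in the ambient
    space: near [x] the path can be lifted to the subtype [C]. *)
Lemma total_ext_cvg (F : set (std M)) (T : topologicalType) (x : T) (g : T -> std M) :
  face (flip_pairing P) F C -> {for x, continuous g} ->
  (\forall y \near x, relint F (g y)) -> f (g y) @[y --> x] --> f (g x).
Proof.
move=> fF cg rg; have [_ _ _ /(_ F fF)/subspace_continuousP phic] := set_valP phi.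
have CF u : relint F u -> C u.
  by case: fF => v _ FE /nbhs_singleton; rewrite FE => -[].
have rx := nbhs_singleton rg; have Cx := CF _ rx.
pose h y : C := if pselect (C (g y)) is left Cy then SigSub (mem_set Cy)
                else SigSub (mem_set Cx).
have hE y : C (g y) -> val (h y) = g y by rewrite /h; case: pselect.
have hx : h x = SigSub (mem_set Cx) by apply: val_inj; rewrite hE.
have h_cvg : h y @[y --> x] --> within [set u : C | relint F (val u)] (nbhs (h x)).
  have hc : h y @[y --> x] --> h x.
    apply: (@cvg_initial _ _ (val : C -> std M)); rewrite hE //.
    by apply: cvg_trans cg; apply: near_eq_cvg; apply: filterS rg => y /CF/hE ->.
  move=> A /hc; apply: filterS2 rg => y ry; apply.
  by rewrite /= hE //; exact: CF.
rewrite -(hE x) // total_extE.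
have := cvg_comp _ _ h_cvg (phic (h x) _); rewrite /= hE // => /(_ rx).
apply: cvg_trans; apply: near_eq_cvg; apply: filterS rg => y /CF Cy /=.
by rewrite -(hE y Cy) total_extE.
Qed.

End Homc.

Section OrbitFunctions.
Context {R : realType} {M N : vectType R} (P : dual_pairing M N).

(** The point [t . x_k] of [V_k], extended to all of [M]. *)
Definition orbit_fun (k : set (std N)) (t : std N) (u : std M) : R :=
  tchar P t u * (`[< annihilator P k u >])%:R.

Lemma orbit_fun_in k t u : annihilator P k u -> orbit_fun k t u = tchar P t u.
Proof. by move=> ku; rewrite /orbit_fun asboolT // mulr1. Qed.

Lemma orbit_fun_out k t u : ~ annihilator P k u -> orbit_fun k t u = 0.
Proof. by move=> ku; rewrite /orbit_fun asboolF // mulr0. Qed.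

Lemma orbit_fun_gt0 k t u : 0 < orbit_fun k t u <-> annihilator P k u.
Proof.
split=> [|ku]; last by rewrite orbit_fun_in // expR_gt0.
by apply: contraPP => /orbit_fun_out ->; rewrite ltxx.
Qed.

(** As the value at [w] is nonzero, it can be divided out: the value at [u] is
    known from one at [u + w *+ n]. Charts are compared in this way. *)
Lemma orbit_fun_addMn k t u w n : annihilator P k w ->
  orbit_fun k t (u + w *+ n) = orbit_fun k t u * orbit_fun k t w ^+ n.
Proof.
move=> kw; rewrite (orbit_fun_in t kw).
have -> : orbit_fun k t (u + w *+ n) = orbit_fun k t u * tchar P t (w *+ n).
  rewrite /orbit_fun tchar_addr mulrAC; congr (_ * _%:R * _); congr nat_of_bool.
  apply: asbool_equiv_eq; split=> ku; last exact/annihilatorD/annihilatorMn.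
  rewrite -(addrK (w *+ n) u); apply: annihilatorD => //.
  by rewrite -scaleN1r; exact/annihilatorZ/annihilatorMn.
by rewrite /tchar pairingMnl -mulrN expRM_natl.
Qed.

(** The line through [x] in the direction [y] lies in the span of [F], so near [x]
    it lies in [F]. *)
Lemma relint_move (F : set (std M)) x y : relint F x -> F y ->
  exists2 e : R, 0 < e & F (x - e *: y).
Proof.
move=> rx Fy; have Fx := nbhs_singleton rx.
have span_line a : linspan F (x + a *: y).
  exists [:: x; y]; first by move=> z; rewrite !inE => /orP[] /eqP ->.
  by apply: memvD; [|apply: memvZ]; apply: memv_span; rewrite !inE eqxx ?orbT.
have : \forall a \near (0 : R), F (x + a *: y).
  have wx : within (linspan F) (nbhs (x : std M)) F.
    by have := span_line 0; rewrite scale0r addr0 => /nbhs_subspace_in ->.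
  have := @std_line_continuous R M x y 0; rewrite /continuous_at scale0r addr0.
  move=> /(_ _ wx) h.
  have {}h : \forall a \near (0 : R), linspan F (x + a *: y) -> F (x + a *: y) by exact: h.
  by apply: filterS h => a; apply; exact: span_line.
move=> /nbhs_ballP[e /= e0 Fe]; exists (e / 2); rewrite ?divr_gt0 // -scaleNr.
apply: Fe; rewrite /ball /= sub0r opprK gtr0_norm ?divr_gt0 //.
by rewrite ltr_pdivrMr // ltr_pMr // ltr1n.
Qed.

(** A functional nonnegative on [F] and zero at a relative interior point [x]
    vanishes on [F], since it is nonnegative at points [x - e *: y]. *)
Lemma relint_annihilator (s k : set (std N)) (F : set (std M)) x y :
  k `<=` s -> F `<=` dual_cone P s -> relint F x -> F y ->
  annihilator P k x -> annihilator P k y.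
Proof.
move=> ks Fs rx Fy kx v kv; have [e e0 Fe] := relint_move rx Fy.
have sv := ks _ kv; have := Fs _ Fe v sv.
rewrite pairingBl pairingZl kx // sub0r oppr_ge0 pmulr_rle0 // => y_le0.
by apply/eqP; rewrite eq_le y_le0 (Fs _ Fy).
Qed.

(** The support of the indicator below contains the relative interior of a face
    or misses it, so the indicator is constant there. *)
Lemma annihilator_homc (s k : set (std N)) : k `<=` s ->
  homc P (dual_cone P s) (fun u : dual_cone P s => (`[< annihilator P k (val u) >])%:R).
Proof.
move=> ks; split.
- by move=> u; rewrite ler0n.
- by move=> u ->; rewrite asboolT // => v _; exact: pairing0l.
- move=> u v w ->; rewrite -natrM mulnb -asbool_and; congr (nat_of_bool _)%:R.
  by apply: asbool_equiv_eq; apply: (annihilator_addE ks); exact: set_valP.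
- move=> F [v0 _ FE]; have Fs : F `<=` dual_cone P s by rewrite FE => u [].
  apply/subspace_continuousP => x /= rx; apply: cvg_near_cst.
  rewrite near_withinE; apply: nearW => y /= ry; congr (nat_of_bool _)%:R.
  apply: asbool_equiv_eq; split.
    exact: (relint_annihilator ks Fs ry (nbhs_singleton rx)).
  exact: (relint_annihilator ks Fs rx (nbhs_singleton ry)).
Qed.

(** The image of [t . x_k] in [V_s], given by its values rather than as a
    restriction, so that no fan enters. *)
Definition orbit_point (s k : set (std N)) (ks : k `<=` s) (t : std N) :
    homc P (dual_cone P s) :=
  torus_hom t (SigSub (mem_set (annihilator_homc ks))).

Lemma distinguishedE s t (u : dual_cone P s) :
  val (torus_hom t (distinguished P s)) u = orbit_fun s t (val u).
Proof. by []. Qed.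

End OrbitFunctions.

(** * Points of a chart are orbit functions *)

Section Classification.
Context {R : realType} {M N : vectType R} (P : dual_pairing M N).
Context (s : set (std N)) (gen : seq N).
Hypothesis gens : generated_by s gen.
Context (phi : homc P (dual_cone P s)).
Local Notation f := (total_ext (val phi)).
Local Notation C := (dual_cone P s).

Lemma total_ext_Mn u n : C u -> f (u *+ n) = f u ^+ n.
Proof.
move=> Cu; elim: n => [|n IH]; first by rewrite mulr0n total_ext0 //; exact: dual_cone0.
have Cn := @dual_coneMn _ _ _ P s u n Cu.
by rewrite mulrS total_extD // ?IH ?exprS //; exact: dual_coneD.
Qed.

(** Add up one element of the support for each generator that the support does
    not annihilate: a sum is zero at a generator only if each term is. *)
Lemma exists_generic_support : exists u0, [/\ C u0, 0 < f u0 &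
  forall u, C u -> 0 < f u -> forall v, v \in gen -> P u0 v = 0 -> P u v = 0].
Proof.
have [u0 [Cu0 fu0 u0P]] : exists u0, [/\ C u0, 0 < f u0 & forall v, v \in gen ->
    forall u, C u -> 0 < f u -> 0 < P u v -> 0 < P u0 v].
  have : forall v, v \in gen -> s v by exact: gens.1.
  elim: gen => [_|v g IH gs].
    by exists 0; split; rewrite ?total_ext0 //; exact: dual_cone0.
  have [w wg|u0 [Cu0 fu0 u0P]] := IH; first by apply: gs; rewrite inE wg orbT.
  have [[u [Cu fu uv]]|nou] := pselect (exists u, [/\ C u, 0 < f u & 0 < P u v]).
    exists (u + u0); split; first exact: dual_coneD.
      by rewrite total_extD ?mulr_gt0 //; exact: dual_coneD.
    move=> w; rewrite inE => /orP[/eqP ->|wg] u' Cu' fu' u'w; rewrite pairingDl.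
      by rewrite ltr_pwDl // Cu0 //; apply: gs; rewrite mem_head.
    rewrite ltr_wpDl ?(u0P w wg u') // Cu //.
    by apply: gs; rewrite inE wg orbT.
  exists u0; split=> // w; rewrite inE => /orP[/eqP ->|wg] u Cu fu uw; last exact: u0P fu uw.
  by case: nou; exists u.
exists u0; split=> // u Cu fu v vg u0v; apply/eqP; rewrite eq_le.
rewrite (Cu v) ?andbT; last exact: gens.1.
by rewrite leNgt; apply/negP => /(u0P v vg u Cu fu); rewrite u0v ltxx.
Qed.

Section Support.
Context (u0 : std M) (Cu0 : C u0) (fu0 : 0 < f u0).
Hypothesis u0_generic :
  forall u, C u -> 0 < f u -> forall v, v \in gen -> P u0 v = 0 -> P u v = 0.

Let k : set (std N) := [set v | s v /\ P u0 v = 0].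

Let annE u : annihilator P k u <-> forall v, v \in gen -> P u0 v = 0 -> P u v = 0.
Proof. exact: (annihilator_generated gens u Cu0). Qed.

Let absorb_ann w : annihilator P k w -> exists n, C (w + u0 *+ n).
Proof.
by move=> kw; apply: (dual_cone_absorb gens Cu0) => v kv; rewrite kw.
Qed.

Let u0_ann : annihilator P k u0. Proof. by move=> v []. Qed.

(** A multiple of [u0] is [u] plus an element of the dual cone, so [f u] is a
    factor of a power of [f u0]. *)
Let supportE u : C u -> 0 < f u <-> annihilator P k u.
Proof.
move=> Cu; split=> [fu|ku]; first by apply/annE => v; exact: u0_generic.
have [n Cn] : exists n, C (- u + u0 *+ n).
  by apply: absorb_ann; rewrite -scaleN1r; exact: annihilatorZ.
have E : u0 *+ n = u + (- u + u0 *+ n) by rewrite addrA subrr add0r.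
have := exprn_gt0 n fu0; rewrite -total_ext_Mn // {1}E total_extD -?E //.
  have := total_ext_ge0 phi u; rewrite le_eqVlt => /orP[/eqP <-|//].
  by rewrite mul0r ltxx.
exact: dual_coneMn.
Qed.

Let F : set (std M) := [set u | C u /\ annihilator P k u].

(** [F] is cut out by the sum of the generators on which [u0] vanishes. *)
Let F_face : face (flip_pairing P) F C.
Proof.
exists (\sum_(v <- gen | P u0 v == 0) v).
  move=> u Cu; rewrite flip_pairingE pairing_sumr big_seq_cond; apply: sumr_ge0 => v /andP[vg _].
  by apply: Cu; exact: gens.1.
apply/seteqP; split=> u [Cu]; [rewrite annE => ku|rewrite flip_pairingE => /eqP ku]; split=> //.
  rewrite flip_pairingE pairing_sumr big_seq_cond; apply: big1 => v /andP[vg /eqP].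
  exact: ku.
apply/annE => v vg u0v; move: ku; rewrite pairing_sumr big_seq_cond psumr_eq0.
  by move=> /allP/(_ v vg); rewrite vg u0v eqxx => /eqP.
by move=> w /andP[wg _]; apply: Cu; exact: gens.1.
Qed.

(** Elements of the span of [F] annihilate [k], and near [u] they stay positive
    on the other generators. *)
Let F_relint u : annihilator P k u ->
  (forall v, v \in gen -> 0 < P u0 v -> 0 < P u v) -> relint F u.
Proof.
move=> ku upos.
have Fpos x : annihilator P k x ->
    (forall v, v \in gen -> 0 < P u v -> 0 < P x v) -> F x.
  move=> kx xpos; split=> //; apply: (dual_cone_generated gens) => v vg.
  have := Cu0 (gens.1 _ vg); rewrite le_eqVlt => /orP[/eqP u0v|u0v].
    by rewrite (annE x).1.
  by apply/ltW/xpos => //; exact: upos.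
have spanF x : linspan F x -> annihilator P k x.
  move=> [t tF xt] v kv; have /coord_span -> : x \in span (in_tuple t) by [].
  rewrite (functional_sum (pairing_linearl P v)); apply: big1 => i _.
  by rewrite pairingZl; have [_ ->] := tF _ (mem_nth 0 (ltn_ord i)); rewrite ?mulr0.
have Fu : F u by apply: Fpos.
rewrite /relint /interior /=.
have <- : within (linspan F) (nbhs (u : std M)) = nbhs (u : subspace (linspan F)).
  apply: nbhs_subspace_in; exists [:: u]; last by rewrite memv_span ?mem_head.
  by move=> y; rewrite inE => /eqP ->.
have := @near_pairing_gt0 _ _ _ P gen _ u id (fun _ => id).
by apply: filterS => x xpos /spanF kx; exact: Fpos.
Qed.

Let L u := ln (f u).

Let L_D u w : C u -> C w -> annihilator P k u -> annihilator P k w ->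
  L (u + w) = L u + L w.
Proof.
move=> Cu Cw ku kw; rewrite /L total_extD //; last exact: dual_coneD.
by rewrite lnM // posrE; apply/supportE.
Qed.

Let L_Mn n : L (u0 *+ n) = n%:R * L u0.
Proof. by rewrite /L total_ext_Mn // lnXn // mulr_natl. Qed.

(** The extension of [L] from the support to the annihilator of [k]. The value
    does not depend on [n], by additivity of [L]. *)
Let exists_log : exists H : M -> R, forall w, annihilator P k w ->
  forall n, C (w + u0 *+ n) -> H w = L (w + u0 *+ n) - n%:R * L u0.
Proof.
suff /choice[H HE] : forall w, exists x : R, annihilator P k w ->
    forall n, C (w + u0 *+ n) -> x = L (w + u0 *+ n) - n%:R * L u0 by exists H.
move=> w; have [kw|] := pselect (annihilator P k w); last by exists 0.
have [m Cm] := absorb_ann kw.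
exists (L (w + u0 *+ m) - m%:R * L u0) => _ n Cn.
have kn i : annihilator P k (u0 *+ i) by exact: annihilatorMn.
have kwn i : annihilator P k (w + u0 *+ i) by exact: annihilatorD.
have Ci i : C (u0 *+ i) by exact: dual_coneMn.
apply/eqP; rewrite subr_eq addrAC eq_sym subr_eq -!L_Mn -!L_D //.
by rewrite addrAC.
Qed.

(** The extension is additive. On the line [a *: w] it is the variation of [L] on
    the line [u0 + a *: w], which is continuous at the relative interior point
    [u0]; so it is linear there. *)
Let log_char : exists t, forall u, C u -> annihilator P k u -> f u = tchar P t u.
Proof.
have [H HE] := exists_log.
have H_L u : C u -> annihilator P k u -> H u = L u.
  by move=> Cu ku; rewrite (HE u ku 0%N) mulr0n addr0 // mul0r subr0.
have H_D u w : annihilator P k u -> annihilator P k w -> H (u + w) = H u + H w.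
  move=> ku kw; have [n Cn] := absorb_ann ku; have [m Cm] := absorb_ann kw.
  have E : u + w + u0 *+ (n + m) = (u + u0 *+ n) + (w + u0 *+ m).
    by rewrite mulrnDr addrACA.
  rewrite (HE _ (annihilatorD ku kw) (n + m)%N) E; last exact: dual_coneD.
  rewrite (HE u ku n) // (HE w kw m) // L_D //; try exact/annihilatorD/annihilatorMn.
  by rewrite natrD mulrDl opprD addrACA.
have H_Z a w : annihilator P k w -> H (a *: w) = a * H w.
  move=> kw; rewrite -{2}[w]scale1r.
  apply: (@additive_continuous_linear _ (fun a => H (a *: w))) => [x y|].
    by rewrite scalerDl H_D //; exact: annihilatorZ.
  pose g (b : R) : std M := u0 + b *: w.
  have g_cont : {for 0, continuous g} by exact: std_line_continuous.
  have g0 : g 0 = u0 by rewrite /g scale0r addr0.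
  have kg b : annihilator P k (g b) by apply: annihilatorD => //; exact: annihilatorZ.
  have g_relint : \forall b \near 0, relint F (g b).
    have := near_pairing_gt0 P gen g_cont; rewrite g0.
    by apply: filterS => b gb; exact: F_relint.
  have := @total_ext_cvg _ _ _ _ _ phi _ _ _ _ F_face g_cont g_relint; rewrite g0 => fg.
  have Lg : L (g b) - L u0 @[b --> 0] --> (0 : R).
    rewrite -[X in _ --> X](subrr (L u0)); apply: cvgB; last exact: cvg_cst.
    exact: (cvg_comp _ _ fg (continuous_ln fu0)).
  apply: cvg_trans Lg; apply: near_eq_cvg; apply: filterS g_relint => b /nbhs_singleton[Cg _].
  have E : b *: w + u0 *+ 1 = g b by rewrite mulr1n addrC.
  by rewrite (HE _ (annihilatorZ _ kw) 1%N) E // mul1r.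
have [W WE] : exists W : {vspace M}, forall u, u \in W <-> annihilator P k u.
  have [W WE] := common_kernel P [seq v <- gen | P u0 v == 0]; exists W => u.
  rewrite WE annE; split=> [h v vg /eqP u0v|h v]; first by apply: h; rewrite mem_filter u0v.
  by rewrite mem_filter => /andP[/eqP u0v vg]; exact: h.
pose b := vbasis W.
have bk (i : 'I_(\dim W)) : annihilator P k b`_i.
  by apply/WE/vbasis_mem/mem_nth; rewrite size_tuple.
(* The sign is that of the exponent in [tchar]. *)
have [|t tE] := @pairing_represents _ _ _ P
    (fun u => - \sum_(i < \dim W) coord b i u * H b`_i).
  move=> c u w; rewrite mulrN -opprD; congr (- _); rewrite mulr_sumr -big_split.
  by apply: eq_bigr => i _ /=; rewrite linearP mulrDl mulrA.
exists t => u Cu ku; rewrite /tchar -tE opprK.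
have -> : \sum_(i < \dim W) coord b i u * H b`_i = L u.
  rewrite -H_L // {2}(coord_vbasis ((WE u).2 ku)).
  have H0 : H 0 = 0 by rewrite -(scale0r (0 : M)) H_Z ?mul0r // => v _; rewrite pairing0l.
  suff [_ ->] : annihilator P k (\sum_(i < \dim W) coord b i u *: b`_i) /\
      \sum_(i < \dim W) coord b i u * H b`_i =
      H (\sum_(i < \dim W) coord b i u *: b`_i) by [].
  apply: (big_rec2 (fun x y => annihilator P k y /\ x = H y)).
    by split=> [v _|]; rewrite ?pairing0l.
  move=> i x y _ [ky ->]; have kb := annihilatorZ (coord b i u) (bk i).
  by split; rewrite ?H_D ?H_Z //; exact: annihilatorD.
by rewrite /L lnK // posrE; apply/supportE.
Qed.

Lemma support_orbit_fun : exists t, forall u : C, val phi u = orbit_fun P k t (val u).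
Proof.
have [t tE] := log_char; exists t => u; rewrite -total_extE.
have Cu := set_valP u.
have [ku|ku] := pselect (annihilator P k (val u)); first by rewrite orbit_fun_in // tE.
rewrite orbit_fun_out //; apply/eqP; rewrite eq_le total_ext_ge0 andbT leNgt.
by apply/negP => fu; apply: ku; apply/supportE.
Qed.

End Support.

Lemma homc_orbit_fun : exists k t, face P k s /\
  forall u : C, val phi u = orbit_fun P k t (val u).
Proof.
have [u0 [Cu0 fu0 gen0]] := exists_generic_support.
have [t tE] := support_orbit_fun Cu0 fu0 gen0.
by exists [set v | s v /\ P u0 v = 0], t; split=> //; exists u0.
Qed.

End Classification.

(** The functional [w] cutting out [k] is in the support of the first function,
    hence of the second, so it vanishes on [k']; by symmetry [k = k']. The
    characters agree on the support, and every [u] annihilating [k] is the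
    difference of [u + w *+ n] and [w *+ n] in the support. *)
Lemma orbit_fun_inj (R : realType) (M N : vectType R) (P : dual_pairing M N)
    (s k k' : set (std N)) (gen : seq N) (t t' : std N) :
  generated_by s gen -> face P k s -> face P k' s ->
  (forall u, dual_cone P s u -> orbit_fun P k t u = orbit_fun P k' t' u) ->
  k = k' /\ forall u, annihilator P k u -> P u t = P u t'.
Proof.
move=> gens fk fk' tt'.
have sub a b x y : face P a s -> face P b s ->
    (forall u, dual_cone P s u -> orbit_fun P a x u = orbit_fun P b y u) -> b `<=` a.
  move=> [w sw ->] [w' _ bE] ab v bv.
  have sv : s v by move: bv; rewrite bE => -[].
  split=> //; suff bw : annihilator P b w by exact: bw.
  by apply/(orbit_fun_gt0 P _ y); rewrite -ab //; apply/orbit_fun_gt0 => z [].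
have kk' : k = k'.
  apply/seteqP; split; last exact: (sub _ _ _ _ fk fk' tt').
  by apply: (sub _ _ t' t fk' fk) => u su; rewrite tt'.
split=> // u ku; rewrite -kk' in tt'; case: fk => w sw kE.
have kw : annihilator P k w by rewrite kE => v [].
have [|n sn] := @dual_cone_absorb _ _ _ P s gen w u gens sw.
  by move=> v; rewrite -[X in X v]kE => /ku ->.
have eqP_on z : dual_cone P s z -> annihilator P k z -> P z t = P z t'.
  move=> sz kz; have := tt' _ sz; rewrite !orbit_fun_in // => /expR_inj.
  by move/oppr_inj.
have := eqP_on _ sn (annihilatorD ku (annihilatorMn _ kw)).
by rewrite !pairingDl !pairingMnl (eqP_on w sw kw) => /addIr.
Qed.

(** * Points of the toric variety *)

Section Variety.
Context {R : realType} {M N : vectType R} (P : dual_pairing M N).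
Context (Sigma : set (set (std N))).
Hypothesis fan : is_fan P Sigma.

Local Notation Y := (toric_variety P Sigma).
Local Notation act := (@torus_act R M N P Sigma).
Local Notation x_ := (@toric_point R M N P Sigma).

Lemma fan_generated (s : Sigma) : exists gen, generated_by (val s) gen.
Proof. by case: fan => _ + _ _; move/(_ _ (set_valP s))/polyhedral_generated. Qed.

Lemma fan_face (k s : Sigma) : val k `<=` val s -> face P (val k) (val s).
Proof.
move=> ks; case: fan => _ _ _ /(_ _ _ (set_valP s) (set_valP k))[+ _].
by rewrite setIidr.
Qed.

(** The point [x] of a chart is the image of [t . x_k]. Such [k] and [t] are used
    as coordinates of [x] that survive the gluing. *)
Definition orbit_coords (x : charts P Sigma) (k : Sigma) (t : std N) : Prop :=
  val k `<=` val (tag x) /\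
  forall u, val (tagged x) u = orbit_fun P (val k) t (val u).

Lemma exists_orbit_coords x : exists k t, orbit_coords x k t.
Proof.
have [gen gens] := fan_generated (tag x).
have [k [t [fk kt]]] := homc_orbit_fun gens (tagged x).
have Sk : Sigma k by case: fan => _ _ + _; apply; last exact: fk; exact: set_valP.
exists (SigSub (mem_set Sk)), t; split=> //.
by case: fk => w _ /= -> v [].
Qed.

Lemma orbit_coords_inj x k t k' t' :
  orbit_coords x k t -> orbit_coords x k' t' ->
  k = k' /\ forall u, annihilator P (val k) u -> P u t = P u t'.
Proof.
move=> [kx xt] [kx' xt']; have [gen gens] := fan_generated (tag x).
have [|kk' ut] := orbit_fun_inj gens (fan_face kx) (fan_face kx') (t := t) (t' := t').
  move=> u su; have := xt (SigSub (mem_set su)).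
  by rewrite xt'.
by split=> //; exact: val_inj.
Qed.

Lemma orbit_coords_translate x k t t' :
  (forall u, annihilator P (val k) u -> P u t = P u t') ->
  orbit_coords x k t -> orbit_coords x k t'.
Proof.
move=> tt' [kx xt]; split=> // u; rewrite xt.
have [ku|ku] := pselect (annihilator P (val k) (val u)).
  by rewrite !orbit_fun_in // /tchar tt'.
by rewrite !orbit_fun_out.
Qed.

(** Coordinates of [x] are coordinates of its restriction [y] by definition. The
    converse holds because [x] has coordinates and those of [y] are unique. *)
Lemma restricts_to_orbit_coords x y k t : restricts_to x y ->
  orbit_coords x k t <-> orbit_coords y k t.
Proof.
move=> [[w _ xyE] xy].
have sub : val (tag x) `<=` val (tag y) by rewrite xyE => v [].
have dual (u : dual_cone P (val (tag y))) : dual_cone P (val (tag x)) (val u).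
  by move=> v /sub yv; exact: set_valP u v yv.
have down k' t' : orbit_coords x k' t' -> orbit_coords y k' t'.
  move=> [kx xt]; split=> [|u]; first exact: subset_trans sub.
  by rewrite -(xy (SigSub (mem_set (dual u))) u erefl) xt.
split=> [|ykt]; first exact: down.
have [k' [t' xkt']] := exists_orbit_coords x.
have [<-] := orbit_coords_inj (down _ _ xkt') ykt.
by move=> tt'; exact: orbit_coords_translate xkt'.
Qed.

Lemma pi_orbit_coords x y k t : \pi_Y x = \pi_Y y ->
  orbit_coords x k t -> orbit_coords y k t.
Proof.
move=> /toric_variety_eqP xy; suff : orbit_coords x k t <-> orbit_coords y k t by case.
elim: xy => // [a b ab|a b _ ->|a b c _ -> _ ->] //.
exact: restricts_to_orbit_coords.
Qed.

Lemma orbit_coords_pi x k t : orbit_coords x k t -> \pi_Y x = act t (x_ k).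
Proof.
move=> [kx xt]; rewrite /toric_point torus_act_pi; apply/esym/toric_variety_eqP.
apply: rst_step; split; first exact: fan_face.
by move=> u w uw; rewrite xt -uw.
Qed.

Lemma orbit_coords_distinguished k t :
  orbit_coords (torus_charts t (existT _ k (distinguished P (val k)))) k t.
Proof. by split. Qed.

Lemma exists_orbit y : exists k t, y = act t (x_ k).
Proof.
have [k [t xkt]] := exists_orbit_coords (repr y).
by exists k, t; rewrite -(orbit_coords_pi xkt) reprK.
Qed.

Lemma orbit_inj t k t' k' : act t (x_ k) = act t' (x_ k') ->
  k = k' /\ forall u, annihilator P (val k) u -> P u t = P u t'.
Proof.
rewrite /toric_point !torus_act_pi => /pi_orbit_coords.
move=> /(_ _ _ (orbit_coords_distinguished k t)) /orbit_coords_inj; apply.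
exact: orbit_coords_distinguished.
Qed.

Lemma orbit_eq t t' k : (forall u, annihilator P (val k) u -> P u t = P u t') ->
  act t (x_ k) = act t' (x_ k).
Proof.
move=> tt'; have := orbit_coords_distinguished k t.
move=> /(orbit_coords_translate tt')/orbit_coords_pi <-.
by rewrite /toric_point torus_act_pi.
Qed.

End Variety.

(** * Open charts *)

Section ChartTopology.
Context {R : realType} {M N : vectType R} (P : dual_pairing M N).
Context (C : set (std M)).

Lemma cvg_homc (X : Type) (F : set_system X) (FF : Filter F)
    (g : X -> homc P C) (phi : homc P C) :
  (forall u, val (g x) u @[x --> F] --> val phi u) -> g x @[x --> F] --> phi.
Proof.
move=> gphi; apply: (@cvg_initial _ _ (val : homc P C -> {ptws C -> R})).
by apply/pointwise_cvgP => u; exact: gphi.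
Qed.

Lemma homc_eval_continuous (u : C) : continuous (fun phi : homc P C => val phi u).
Proof.
move=> phi; have : val psi @[psi --> phi] --> (val phi : {ptws C -> R}).
  exact: initial_continuous.
move=> val_cvg.
have val_filter := fmap_filter (val : homc P C -> {ptws C -> R}) (nbhs_filter phi).
exact: ((pointwise_cvgP (val phi) val_filter).1 val_cvg u).
Qed.

Lemma tchar_continuousl (u : std M) : continuous (fun t : std N => tchar P t u).
Proof.
move=> t; apply: (@continuous_comp (std N) R R (fun t => - P u t) expR).
  exact: (continuousN (std_scalar_continuous (pairing_linearr P u) (x := t))).
exact: continuous_expR.
Qed.

Lemma torus_hom_continuous :
  continuous (fun p : std N * homc P C => torus_hom p.1 p.2).
Proof.
move=> [t phi]; apply: cvg_homc => u /=; apply: cvgM.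
  apply: (@continuous_comp _ _ _ fst (fun a => tchar P a (val u)) (t, phi)).
    exact: cvg_fst.
  exact: tchar_continuousl.
apply: (@continuous_comp _ _ _ snd (fun psi : homc P C => val psi u) (t, phi)).
  exact: cvg_snd.
exact: homc_eval_continuous.
Qed.

End ChartTopology.

Section OpenCharts.
Context {R : realType} {M N : vectType R} (P : dual_pairing M N).
Context (Sigma : set (set (std N))).
Hypothesis fan : is_fan P Sigma.

Local Notation Y := (toric_variety P Sigma).
Local Notation act := (@torus_act R M N P Sigma).
Local Notation x_ := (@toric_point R M N P Sigma).
Local Notation V := (@chart R M N P Sigma).

Definition chart_map (s : Sigma) (phi : V s) : Y :=
  \pi_Y (existT V s phi).

Lemma chart_map_continuous s : continuous (@chart_map s).
Proof.
move=> phi; apply: (@continuous_comp _ _ _ (existT V s) (\pi_Y)).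
  exact: existT_continuous.
exact: pi_continuous.
Qed.

Lemma chart_map_inj s : injective (@chart_map s).
Proof.
move=> phi psi e; have [k [t phit]] := exists_orbit_coords fan (existT _ s phi).
have [_ psit] := pi_orbit_coords fan e phit; case: phit => _ phit.
by apply: val_inj; apply/funext => u; rewrite [LHS]phit [RHS]psit.
Qed.

(** The transition function. Let [w] cut out the common face of [s] and [r] in [r]. Where two charts
    meet, [phi z = psi (z + w *+ n) / psi w ^+ n] expresses the point [phi] of one
    through the point [psi] of the other; the formula holds on the open set
    where [psi w > 0]. *)
Lemma chart_transition (s r : Sigma) (phi0 : V s) (psi0 : V r) :
  chart_map phi0 = chart_map psi0 ->
  exists2 G : V r -> V s, G psi @[psi --> psi0] --> phi0 &
    \forall psi \near psi0, chart_map (G psi) = chart_map psi.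
Proof.
move=> e0; have [k [t phit]] := exists_orbit_coords fan (existT _ s phi0).
have psit := pi_orbit_coords fan e0 phit.
have [w rw srE] : face P (val s `&` val r) (val r).
  by case: fan => _ _ _ /(_ _ _ (set_valP s) (set_valP r))[].
have [gen gens] := fan_generated fan r.
pose w' : dual_cone P (val r) := SigSub (mem_set rw).
have ann_w j : val j `<=` val r -> annihilator P (val j) w <-> val j `<=` val s.
  move=> jr; split=> [jw v jv|js v jv].
    have : (val s `&` val r) v by rewrite srE; split; [exact: jr|exact: jw].
    by case.
  have : (val s `&` val r) v by split; [exact: js|exact: jr].
  by rewrite srE => -[].
have near_w : \forall psi \near psi0, 0 < val psi w'.
  apply: (cvgr_gt _ (homc_eval_continuous (u := w') (x := psi0))).
  rewrite [ltRHS](psit.2 w'); apply/orbit_fun_gt0/ann_w; first exact: psit.1.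
  exact: phit.1.
have [G GP] : exists G : V r -> V s,
    forall psi, 0 < val psi w' -> chart_map (G psi) = chart_map psi.
  suff /choice[G GP] : forall psi, exists phi : V s,
    0 < val psi w' -> chart_map phi = chart_map psi by exists G.
  move=> psi; have [j [x psix]] := exists_orbit_coords fan (existT _ r psi).
  have [psiw|] := pselect (0 < val psi w'); last by exists phi0.
  have js : val j `<=` val s.
    apply/ann_w; first exact: psix.1.
    by apply/(orbit_fun_gt0 P (val j) x); have := psix.2 w'; rewrite /= => <-.
  exists (orbit_point P js x) => _.
  rewrite /chart_map (orbit_coords_pi fan psix); apply: (orbit_coords_pi fan).
  by split.
exists G; last by apply: filterS near_w => psi; exact: GP.
have value (phi : V s) (psi : V r) z n (sz : dual_cone P (val s) z)
    (rz : dual_cone P (val r) (z + w *+ n)) :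
    chart_map phi = chart_map psi -> 0 < val psi w' ->
    val phi (SigSub (mem_set sz)) =
    val psi (SigSub (mem_set rz)) / val psi w' ^+ n.
  move=> e psiw; have [j [x phix]] := exists_orbit_coords fan (existT _ s phi).
  have psix := pi_orbit_coords fan e phix.
  rewrite [LHS]phix.2 [val psi _](psix.2 (SigSub (mem_set rz))) (psix.2 w') /=.
  have psiw' : 0 < orbit_fun P (val j) x w by have := psix.2 w'; rewrite /= => <-.
  by rewrite orbit_fun_addMn ?mulfK ?expf_neq0 ?gt_eqF //; apply/orbit_fun_gt0/psiw'.
apply: (@cvg_homc _ _ _ _ _ _ _ (nbhs_filter psi0)) => u; have su := set_valP u.
have [|n rz] := @dual_cone_absorb _ _ _ P (val r) gen w (val u) gens rw.
  by move=> v; rewrite -[X in X v]srE => -[sv _]; exact: su.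
have -> : u = SigSub (mem_set su) by exact: val_inj.
rewrite (value _ psi0 _ n su rz e0 (nbhs_singleton near_w)).
have near_value : \forall psi \near psi0,
    val psi (SigSub (mem_set rz)) / val psi w' ^+ n =
    val (G psi) (SigSub (mem_set su)).
  by apply: filterS near_w => psi psiw; rewrite (value _ psi _ n su rz) //; exact: GP.
apply: cvg_trans (near_eq_cvg near_value) _.
apply: cvgM; first exact: homc_eval_continuous.
apply: cvgV; first by rewrite expf_neq0 // gt_eqF // (nbhs_singleton near_w).
have := @continuous_comp _ _ _ (fun psi : V r => val psi w') (fun y : R => y ^+ n) psi0.
apply; last exact: exprn_continuous.
exact: homc_eval_continuous.
Qed.

(** The charts are open, because the transition functions are continuous and
    defined near each point of an overlap. *)
Lemma chart_map_nbhs s (phi : V s) A :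
  nbhs phi A -> nbhs (chart_map phi) (@chart_map s @` A).
Proof.
move=> phiA.
suff oA : open (@chart_map s @` interior A).
  have : nbhs (chart_map phi) (@chart_map s @` interior A).
    by apply: open_nbhs_nbhs; split=> //; exists phi.
  by apply: filterS; apply: image_subset; exact: interior_subset.
rewrite /open /= /quotient_open; apply/sigT_openP => r; rewrite openE.
move=> psi0 [phi0 Aphi0 e0]; have [G G0 GP] := chart_transition e0.
have : \forall psi \near psi0, interior A (G psi).
  by apply: G0; apply: open_nbhs_nbhs; split=> //; exact: open_interior.
by apply: filterS2 GP => psi e AG; exists (G psi).
Qed.

End OpenCharts.

(** * The torus action, cells and their closures *)

Section Cells.
Context {R : realType} {M N : vectType R} (P : dual_pairing M N).
Context (Sigma : set (set (std N))).
Hypothesis fan : is_fan P Sigma.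

Local Notation Y := (toric_variety P Sigma).
Local Notation act := (@torus_act R M N P Sigma).
Local Notation x_ := (@toric_point R M N P Sigma).
Local Notation U := (@toric_cell R M N P Sigma).
Local Notation V := (@chart R M N P Sigma).

Lemma exists_chart (y : Y) : exists (s : Sigma) (phi : V s), y = chart_map phi.
Proof.
exists (tag (repr y)), (tagged (repr y)); rewrite /chart_map -[LHS]reprK.
by congr (\pi_Y _); case: (repr y).
Qed.

Lemma torus_act_chart t s (phi : V s) :
  act t (chart_map phi) = chart_map (torus_hom t phi).
Proof. exact: torus_act_pi. Qed.

Lemma toric_point_chart s : x_ s = chart_map (distinguished P (val s) : V s).
Proof. by []. Qed.

Lemma torus_act0 y : act 0 y = y.
Proof.
have [s [phi ->]] := exists_chart y; rewrite torus_act_chart; congr chart_map.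
by apply: val_inj; apply/funext => u /=; rewrite tchar0 mul1r.
Qed.

Lemma torus_actD t t' y : act (t + t') y = act t (act t' y).
Proof.
have [s [phi ->]] := exists_chart y; rewrite !torus_act_chart; congr chart_map.
by apply: val_inj; apply/funext => u /=; rewrite tcharD mulrA.
Qed.

(** The action lifts to the charts, whose maps to [Y] are open; so it is
    continuous although a product of quotient maps need not be one. *)
Lemma torus_act_continuous : continuous (fun p : std N * Y => act p.1 p.2).
Proof.
move=> [t y]; have [s [phi ->]] := exists_chart y => W /= W_nbhs.
have lift : {for (t, phi), continuous
    (fun p : std N * V s => chart_map (torus_hom p.1 p.2))}.
  apply: (@continuous_comp _ _ _ (fun p : std N * V s => torus_hom p.1 p.2)
    (@chart_map _ _ _ P Sigma s)).
    exact: torus_hom_continuous.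
  exact: chart_map_continuous.
have : nbhs (chart_map (torus_hom t phi)) W by rewrite -torus_act_chart.
move=> /lift[[A B] /= [At Bphi] AB].
exists (A, @chart_map _ _ _ P Sigma s @` B) => /=.
  by split=> //; exact: chart_map_nbhs.
move=> [a z] [/= Aa [psi Bpsi <-]]; rewrite torus_act_chart.
exact: (AB (a, psi)).
Qed.

Lemma torus_act_continuous_r t : continuous (act t).
Proof.
move=> y; apply: (@continuous_comp _ _ _ (fun z : Y => (t, z) : std N * Y)
  (fun p => act p.1 p.2)); last exact: torus_act_continuous.
apply: (@cvg_pair _ _ _ (nbhs y) (nbhs t) (nbhs y) _ _ _ (fun _ => t) id).
  exact: cvg_cst.
exact: cvg_id.
Qed.

Lemma torus_act_continuous_l y : continuous (act ^~ y).
Proof.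
move=> t; apply: (@continuous_comp _ _ _ (fun a : std N => (a, y) : std N * Y)
  (fun p => act p.1 p.2)); last exact: torus_act_continuous.
apply: (@cvg_pair _ _ _ (nbhs t) (nbhs t) (nbhs y) _ _ _ id (fun _ => y)).
  exact: cvg_id.
exact: cvg_cst.
Qed.

Lemma toric_cell_stable s : stable act (U s).
Proof. by move=> t _ [a _ <-]; exists (t + a) => //; rewrite torus_actD. Qed.

Lemma toric_cell_trivIset s t y : U s y -> U t y -> s = t.
Proof. by move=> [a _ <-] [b _ /(orbit_inj fan)[]]. Qed.

(** The pairing of [u] with [t] is minus the logarithm of the value at [u] of the
    point [t . x_k], and values are continuous on the open chart of [k]. *)
Lemma cell_pairing_continuous (k : Sigma) (t : U k -> std N) u :
  (forall z, val z = act (t z) (x_ k)) -> annihilator P (val k) u ->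
  continuous (fun z => P u (t z)).
Proof.
move=> tP ku z0 B B_nbhs.
have du : dual_cone P (val k) u by move=> v kv; rewrite ku.
pose u' : dual_cone P (val k) := SigSub (mem_set du).
pose phi z : V k := torus_hom (t z) (distinguished P (val k)).
have phiE z : val (phi z) u' = expR (- P u (t z)).
  by rewrite distinguishedE orbit_fun_in.
have zE z : val z = chart_map (phi z) by rewrite tP toric_point_chart torus_act_chart.
have log_cvg : - ln (val psi u') @[psi --> phi z0] --> P u (t z0).
  rewrite -[X in _ --> X]opprK -[in X in _ --> X](expRK (- P u (t z0))) -phiE.
  apply: cvgN; first exact: (nbhs_filter (phi z0)).
  have := @continuous_comp _ _ _ (fun psi : V k => val psi u') (@ln R) (phi z0).
  apply; first exact: homc_eval_continuous.
  by apply: continuous_ln; rewrite phiE expR_gt0.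
have log_nbhs : nbhs (phi z0) [set psi : V k | B (- ln (val psi u'))].
  exact: log_cvg.
have val_cont : continuous (val : U k -> Y) by exact: initial_continuous.
have := chart_map_nbhs fan log_nbhs; rewrite -zE => /val_cont chart_nbhs.
have {}chart_nbhs : \forall z \near z0, exists2 psi : V k,
  B (- ln (val psi u')) & chart_map psi = val z by exact: chart_nbhs.
suff : \forall z \near z0, B (P u (t z)) by [].
apply: (@filterS _ _ (nbhs_filter z0) _ _ _ chart_nbhs) => z [psi Bpsi].
rewrite zE => /(chart_map_inj fan) psiE.
by move: Bpsi; rewrite psiE phiE expRK opprK.
Qed.

(** The coordinate functionals of a basis [b] of the annihilator of [k] are
    represented by vectors [e] of [N]. These span a complement of the span of [k],
    as the last clause says in terms of pairings. *)
Lemma annihilator_dual_basis (k : Sigma) : exists r (b : 'I_r -> M) (e : 'I_r -> N),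
  [/\ forall i, annihilator P (val k) (b i),
      forall i j, P (b i) (e j) = (i == j)%:R &
      forall u v, annihilator P (val k) u ->
        P u v = P u (\sum_j P (b j) v *: e j)].
Proof.
have [gen gens] := fan_generated fan k.
have [W WE] := annihilator_vspace P gens; pose b := vbasis W.
have /choice[e eE] (i : 'I_(\dim W)) : exists e : N, forall u, coord b i u = P u e.
  by apply: pairing_represents => a u w; rewrite linearP.
exists (\dim W), (fun i => b`_i), e; split=> [i|i j|u v /WE uW].
- by apply/WE/vbasis_mem/mem_nth; rewrite size_tuple.
- by rewrite -eE coord_free // (basis_free (vbasisP W)).
rewrite [in LHS](coord_vbasis uW) (functional_sum (pairing_linearl P v)) pairing_sumr.
by apply: eq_bigr => i _; rewrite pairingZl pairingZr -eE mulrC.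
Qed.

Definition orbit_map (k : Sigma) (t : std N) : U k :=
  SigSub (mem_set (imageT (act ^~ (x_ k)) t)).

Lemma orbit_map_eq k t t' :
  orbit_map k t = orbit_map k t' <->
  forall u, annihilator P (val k) u -> P u t = P u t'.
Proof.
split=> [/(congr1 val)/(orbit_inj fan)[]//|tt'].
by apply: val_inj; exact: (orbit_eq fan).
Qed.

Lemma orbit_map_continuous k : continuous (orbit_map k).
Proof.
move=> t; apply: (@cvg_initial _ _ (val : U k -> Y) _ _ (nbhs_filter t)).
exact: torus_act_continuous_l.
Qed.

(** A continuous section of the orbit map: the translation is recovered from its
    pairings with [b], as a combination of the dual vectors. *)
Lemma orbit_map_section k : exists r (b : 'I_r -> M) (e : 'I_r -> N)
    (tau : U k -> std N),
  [/\ continuous tau, forall i, annihilator P (val k) (b i),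
      forall i j, P (b i) (e j) = (i == j)%:R,
      cancel tau (orbit_map k) &
      forall y, tau y = \sum_j P (b j) (tau y) *: e j].
Proof.
have [r [b [e [bk be bP]]]] := annihilator_dual_basis k.
have /choice[t tP] (z : U k) : exists t : std N, val z = act t (x_ k).
  by have [t _ <-] := set_valP z; exists t.
have beS i (c : 'I_r -> R) : P (b i) (\sum_j c j *: e j) = c i.
  rewrite pairing_sumr (bigD1 i) //= pairingZr be eqxx mulr1 big1 ?addr0 // => j.
  by rewrite eq_sym pairingZr be => /negPf ->; rewrite mulr0.
exists r, b, e, (fun z => \sum_j P (b j) (t z) *: e j); split=> //.
- move=> z; apply: (@cvg_std _ _ _ _ (nbhs_filter z)) => l l_scalar.
  have lE y : l (\sum_j P (b j) (t y) *: e j) = \sum_j P (b j) (t y) * l (e j).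
    by rewrite (functional_sum l_scalar); apply: eq_bigr => j _; rewrite (functionalZ l_scalar).
  suff : continuous (fun y : U k => \sum_j P (b j) (t y) * l (e j)).
    by rewrite -(funext lE) => /(_ z).
  apply: continuous_big => [|j _ y]; first exact: add_continuous.
  exact: (cvgMr_tmp (cell_pairing_continuous tP (bk j) (x := y))).
- move=> z; have tz : orbit_map k (t z) = z by apply: val_inj; rewrite [RHS]tP.
  by rewrite -[RHS]tz; apply/orbit_map_eq => u ku; rewrite -bP.
- by move=> z; apply: eq_bigr => j _; rewrite beS.
Qed.

Lemma toric_cell_vect k : exists (W : vectType R) (f : U k -> std W), homeomorphism f.
Proof.
have [r [b [e [tau [tau_cont bk be tauK tauE]]]]] := orbit_map_section k.
pose L (t : N) : 'rV[R]_r := \row_j P (b j) t.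
pose K (c : 'rV[R]_r) : N := \sum_j c 0 j *: e j.
have L_lin : linear L.
  by move=> a u v; apply/rowP => j; rewrite !mxE pairingDr pairingZr.
have K_lin : linear K.
  move=> a u v; rewrite scaler_sumr -big_split; apply: eq_bigr => j _ /=.
  by rewrite !mxE scalerDl scalerA.
have KK : cancel K L.
  move=> c; apply/rowP => i; rewrite mxE pairing_sumr (bigD1 i) //=.
  rewrite pairingZr be eqxx mulr1 big1 ?addr0 // => j.
  by rewrite eq_sym pairingZr be => /negPf ->; rewrite mulr0.
have LtauK : cancel (L \o tau) (@orbit_map k \o K).
  move=> y /=; rewrite -[RHS]tauK; congr orbit_map.
  by rewrite [RHS]tauE; apply: eq_bigr => j _; rewrite mxE.
exists 'rV[R]_r, (L \o tau); split.
  move=> y; apply: (@continuous_comp _ _ _ tau (L : std N -> std 'rV[R]_r)).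
    exact: tau_cont.
  exact: std_linear_continuous.
exists (@orbit_map k \o K); split=> //.
  move=> c; apply: (@continuous_comp _ _ _ (K : std 'rV[R]_r -> std N) (@orbit_map k)).
    exact: std_linear_continuous.
  exact: orbit_map_continuous.
move=> c; rewrite -[RHS]KK; apply/rowP => i; rewrite /= !mxE.
by have /orbit_map_eq -> := tauK (orbit_map k (K c)).
Qed.

Lemma span_quotient_eq (k : Sigma) (t t' : std N) :
  \pi_(span_quotient (val k)) t = \pi_(span_quotient (val k)) t' <->
  forall u, annihilator P (val k) u -> P u t = P u t'.
Proof.
have [gen gens] := fan_generated fan k.
have E : (\pi_(span_quotient (val k)) t = \pi_(span_quotient (val k)) t') <->
    linspan (val k) (t - t').
  have BE := Quotient.idealrBE (span_pred (val k)) t t'.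
  split=> [tt'|/asboolT tt'].
    suff : t - t' \in span_pred (val k) by move/asboolP.
    by rewrite BE; apply/eqP.
  suff /eqP : t == t' %[mod Quotient.quot (span_pred (val k))] by [].
  by rewrite -BE.
rewrite E (linspan_generated P gens); split=> h u /h; rewrite pairingBr.
  by move/eqP; rewrite subr_eq0 => /eqP.
by move=> ->; rewrite subrr.
Qed.

Definition quotient_cell_map k (z : span_quotient (val k)) : U k :=
  orbit_map k (repr z).

Lemma quotient_cell_map_pi k t :
  quotient_cell_map (\pi_(span_quotient (val k)) t) = orbit_map k t.
Proof.
by apply/orbit_map_eq/span_quotient_eq; rewrite reprK.
Qed.

Lemma toric_cell_quotient k :
  equivariantly_homeomorphic act (U k) (@translate R N (val k)).
Proof.
have [r [b [e [tau [tau_cont _ _ tauK _]]]]] := orbit_map_section k.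
exists (@quotient_cell_map k); first split.
- apply/quotient_continuous.
  have -> : @quotient_cell_map k \o \pi_(span_quotient (val k)) = @orbit_map k.
    by apply/funext => t; exact: quotient_cell_map_pi.
  exact: orbit_map_continuous.
- exists (\pi_(span_quotient (val k)) \o tau); split.
  + move=> y; apply: (@continuous_comp _ _ _ tau (\pi_(span_quotient (val k)))).
      exact: tau_cont.
    exact: pi_continuous.
  + move=> z /=; rewrite -[RHS]reprK; apply/span_quotient_eq => u ku.
    by have /orbit_map_eq -> := tauK (quotient_cell_map z).
  + by move=> y; rewrite /= quotient_cell_map_pi tauK.
move=> t z; have -> : translate t z = \pi_(span_quotient (val k)) (t + repr z).
  have := @Quotient.pi_add _ (span_pred (val k)) t (repr z) => piD.
  apply: etrans (esym piD); rewrite /translate; congr (_ + _).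
  exact: (esym (reprK z)).
by rewrite quotient_cell_map_pi /= torus_actD.
Qed.

(** Let [v] be the sum of generators of [s]. On [s^vee] a functional pairs
    positively with [v] unless it annihilates [s], so [n v . x_t] tends to [x_s]. *)
Lemma toric_point_closure (s t : Sigma) :
  val t `<=` val s -> closure (U t) (x_ s).
Proof.
move=> ts B; have [gen gens] := fan_generated fan s.
pose v : N := \sum_(w <- gen) w.
have v_ge0 u : dual_cone P (val s) u -> 0 <= P u v.
  move=> su; rewrite pairing_sumr big_seq; apply: sumr_ge0 => w wg.
  by apply: su; exact: gens.1.
have v_eq0 u : dual_cone P (val s) u -> P u v = 0 -> annihilator P (val s) u.
  move=> su /eqP; rewrite pairing_sumr big_seq psumr_eq0; last first.
    by move=> w wg; apply: su; exact: gens.1.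
  move=> /allP uv.
  apply/(annihilator_generators P gens) => w wg.
  by have := uv w wg; rewrite wg => /eqP.
pose x n : V s := orbit_point P ts (v *+ n).
have xE n u : val (x n) u = orbit_fun P (val t) (v *+ n) (val u) by [].
have dE u : val (distinguished P (val s)) u = (`[< annihilator P (val s) (val u) >])%:R.
  by [].
have x_cvg : x n @[n --> \oo] --> (distinguished P (val s) : V s).
  apply: cvg_homc => u; have su := set_valP u.
  have [su0|su0] := pselect (annihilator P (val s) (val u)).
    apply: cvg_near_cst; apply: nearW => n; rewrite xE orbit_fun_in.
      rewrite dE asboolT // /tchar; have -> : P (val u) (v *+ n) = 0.
        rewrite -scaler_nat pairingZr pairing_sumr big_seq big1 ?mulr0 // => w wg.
        by apply: su0; exact: gens.1.
      by rewrite oppr0 expR0.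
    by move=> w tw; exact: (su0 w (ts w tw)).
  rewrite dE asboolF //.
  have [tu|tu] := pselect (annihilator P (val t) (val u)); last first.
    by apply: cvg_near_cst; apply: nearW => n; rewrite xE orbit_fun_out.
  have uv : 0 < P (val u) v.
    by rewrite lt_def v_ge0 // andbT; apply/eqP => /(v_eq0 _ su).
  suff : (expR (- P (val u) v)) ^+ n @[n --> \oo] --> (0 : R).
    apply: cvg_trans; apply: near_eq_cvg; apply: nearW => n.
    rewrite xE orbit_fun_in // /tchar -scaler_nat pairingZr -mulrN.
    by rewrite expRM_natl.
  apply: cvg_expr; rewrite gtr0_norm ?expR_gt0 //.
  by rewrite -expR0 ltr_expR oppr_lt0.
have := cvg_comp _ _ x_cvg (@chart_map_continuous _ _ _ P Sigma s _).
rewrite -toric_point_chart => h /h [n _ /(_ n (leqnn n)) Bx].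
exists (chart_map (x n)); split=> //; exists (v *+ n) => //=.
by rewrite /chart_map; apply/esym/(orbit_coords_pi fan); split.
Qed.

(** A point of [U s] has the chart of [s] as a neighbourhood, and this chart meets
    only the cells of cones contained in [s]. *)
Lemma closure_toric_cell t :
  closure (U t) = \bigcup_(s in [set s : Sigma | val t `<=` val s]) U s.
Proof.
apply/seteqP; split=> [y cy|y [s ts [a _ <-]] B].
  have [s [a y_s]] := exists_orbit fan y; exists s; last by rewrite y_s; exists a.
  have : nbhs y (@chart_map _ _ _ P Sigma s @` setT).
    rewrite y_s toric_point_chart torus_act_chart; apply: (chart_map_nbhs fan).
    exact: filterT.
  move=> /cy[_ [[b _ <-] [phi _]]].
  have [k [c phic]] := exists_orbit_coords fan (existT V s phi).
  rewrite /chart_map (orbit_coords_pi fan phic) => /(orbit_inj fan)[kt _].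
  by rewrite /= -kt; exact: phic.1.
move=> /(torus_act_continuous_r (t := a)) /(toric_point_closure ts)[z [Utz Bz]].
by exists (act a z); split=> //; exact: toric_cell_stable.
Qed.

Lemma toric_cell_point s : U s (x_ s).
Proof. by exists 0 => //; rewrite torus_act0. Qed.

Lemma toric_cell_in_closure s t : val t `<=` val s <-> U s `<=` closure (U t).
Proof.
rewrite closure_toric_cell; split=> [ts y Uy|/(_ _ (toric_cell_point s))]; first by exists s.
by move=> [k tk Uk]; rewrite (toric_cell_trivIset (toric_cell_point s) Uk).
Qed.

Lemma toric_cell_complex : equivariant_cell_complex act (range U).
Proof.
split.
- split; [exact: torus_act0|exact: torus_actD|exact: torus_act_continuous].
- split; [|split].
  + by apply: finite_image; case: fan => + _ _ _; rewrite (eq_finite_set (card_setT _)).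
  + move=> _ _ [s _ <-] [t _ <-] [y [Us Ut]].
    by rewrite (toric_cell_trivIset Us Ut).
  + apply/seteqP; split=> // y _; have [s [t ->]] := exists_orbit fan y.
    by exists (U s); [exists s|exists t].
- by move=> _ [s _ <-]; exact: toric_cell_stable.
- by move=> _ [s _ <-]; exact: toric_cell_vect.
move=> _ [t _ <-]; exists [set U s | s in [set s : Sigma | val t `<=` val s]].
  by move=> _ [s _ <-]; exists s.
by rewrite closure_toric_cell bigcup_image.
Qed.

End Cells.

Theorem theorem3p11 (R : realType) (M N : vectType R)
    (P : dual_pairing M N) (Sigma : set (set (std N))) :
  is_fan P Sigma ->
  let U := @toric_cell R M N P Sigma in
  let act := @torus_act R M N P Sigma in
  [/\ equivariant_cell_complex act (range U),
      forall c, range U c -> is_orbit act c /\ exists! s : Sigma, c = U s,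
      forall s : Sigma,
        equivariantly_homeomorphic act (U s) (@translate R N (val s)) &
      forall s t : Sigma, val t `<=` val s <-> U s `<=` closure (U t)].
Proof.
move=> fan U act; split; first exact: toric_cell_complex.
- move=> _ [s _ <-]; split; first by exists (toric_point P s).
  exists s; split=> // t Ust; apply: (toric_cell_trivIset fan (toric_cell_point P s)).
  by rewrite -/U -Ust; exact: toric_cell_point.
- exact: toric_cell_quotient.
- exact: toric_cell_in_closure.
Qed.
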